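(* Let $m\geq 7$ be an integer with $m\neq 9$. Then the largest $d$ for which there exists a non-Denniston maximal arc of degree $2^d$ in $\mathrm{PG}(2,2^m)$ generated by a $\{p,q\}$-map is either $\lfloor\frac{m}{2}\rfloor+1$ or $\lfloor\frac{m}{2}\rfloor+2$.
   Context: $\mathrm{Tr}$ denotes the trace from $\mathbb{F}_{2^m}$ to $\mathbb{F}_2$. $\mathrm{PG}(2,2^m)$ is the desarguesian projective plane over $\mathbb{F}_{2^m}$ with homogeneous coordinates $(x,y,z)$. A maximal arc of degree $n$ in $\mathrm{PG}(2,2^m)$ is a set $\mathcal{K}$ of $2^m(n-1)+n$ points such that no $n+1$ points of $\mathcal{K}$ are collinear. For $\alpha,\beta,\lambda\in\mathbb{F}_{2^m}^*$ with $\mathrm{Tr}(\alpha\beta)=1$ (equivalently $\alpha x^2+x+\beta$ irreducible over $\mathbb{F}_{2^m}$) let $F_{\alpha,\beta,\lambda}=\{(x,y,z)\in\mathrm{PG}(2,2^m)\mid \alpha x^2+xy+\beta y^2+\lambda z^2=0\}$, a non-degenerate conic with nucleus $(0,0,1)$, and let $F_0=\{(0,0,1)\}$. Maximal arcs generated by $\{p,q\}$-maps: let $p(x)=\sum_{i=0}^{d-1}a_ix^{2^i-1}$ and $q(x)=\sum_{i=0}^{d-1}b_ix^{2^i-1}$ be in $\mathbb{F}_{2^m}[x]$, and let $A$ be an additive subgroup of order $2^d$ of $\mathbb{F}_{2^m}$ such that $\mathrm{Tr}(p(\lambda)q(\lambda))=1$ for every $\lambda\in A\setminus\{0\}$. Then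 (known theorem of Mathon) the set $\mathcal{K}=F_0\cup\bigcup_{\lambda\in A\setminus\{0\}}F_{p(\lambda),q(\lambda),\lambda}$ is a maximal arc of degree $2^d$ in $\mathrm{PG}(2,2^m)$, called the maximal arc generated by the $\{p,q\}$-map. Denniston maximal arcs: let $Q(x,y)=ax^2+hxy+by^2$ be an irreducible quadratic form over $\mathbb{F}_{2^m}$ (i.e. $h\ne0$ and $\mathrm{Tr}(ab/h^2)=1$) and let $A$ be an additive subgroup of $\mathbb{F}_{2^m}$; then $\{(x,y,1)\in\mathrm{PG}(2,2^m)\mid Q(x,y)\in A\}$ is a maximal arc of degree $|A|$. These arcs, and those projectively equivalent to them, are called Denniston maximal arcs; a maximal arc is non-Denniston if it is not of this kind. *)

(* Defs.v *)
From HB Require Import structures.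
From mathcomp Require Import all_boot all_order all_algebra.

Set Implicit Arguments.
Unset Strict Implicit.
Unset Printing Implicit Defensive.

Import GRing.Theory.
Local Open Scope ring_scope.

Section ProjectivePlane.
Variable F : finFieldType.

(* A subspace of F^3 is encoded by the canonical square matrix <<_>>%MS having
   it as row space, so equality of points is equality of matrices. *)
Definition PG2 : {set 'M[F]_3} :=
  [set P : 'M[F]_3 | (<<P>>%MS == P) && (\rank P == 1)%N].

Definition vec (x y z : F) : 'rV[F]_3 := \row_(i < 3) [:: x; y; z]`_i.

(* The point with homogeneous coordinates (x, y, z), provided these are not
   all zero. *)
Definition point (x y z : F) : 'M[F]_3 := <<vec x y z>>%MS.

Definition collinear (S : {set 'M[F]_3}) : Prop :=
  exists2 L : 'M[F]_3, \rank L = 2%N & forall P, P \in S -> (P <= L)%MS.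

Definition maximal_arc (n : nat) (K : {set 'M[F]_3}) : Prop :=
  [/\ K \subset PG2,
      #|K| = (#|F| * (n - 1) + n)%N &
      forall S : {set 'M[F]_3}, S \subset K -> #|S| = n.+1 -> ~ collinear S].

Definition projectively_equivalent (K K' : {set 'M[F]_3}) : Prop :=
  exists2 M : 'M[F]_3, M \in unitmx & K' = [set <<P *m M>>%MS | P in K].

End ProjectivePlane.

Section Arcs.
Variable F : finFieldType.

(* The absolute trace, with value in the prime field inside F; it is used only
   when #|F| is a power of 2. *)
Definition Tr (x : F) : F := \sum_(i < logn 2 #|F|) x ^+ (2 ^ i).

Definition conic (alpha beta lambda : F) : {set 'M[F]_3} :=
  [set point u.1.1 u.1.2 u.2 | u : F * F * F &
    (u != (0, 0, 0)) &&
    (alpha * u.1.1 ^+ 2 + u.1.1 * u.1.2 + beta * u.1.2 ^+ 2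
       + lambda * u.2 ^+ 2 == 0)].

Definition mathon_poly (d : nat) (a : 'I_d -> F) : {poly F} :=
  \sum_(i < d) (a i)%:P * 'X^(2 ^ i - 1).

Definition pq_arc (p q : {poly F}) (A : {set F}) : {set 'M[F]_3} :=
  point 0 0 1 |:
    \bigcup_(lambda in A :\ 0) conic p.[lambda] q.[lambda] lambda.

Definition generated_by_pq_map (d : nat) (K : {set 'M[F]_3}) : Prop :=
  exists (a b : 'I_d -> F) (A : {set F}),
    let p := mathon_poly a in
    let q := mathon_poly b in
    [/\ zmod_closed A, #|A| = (2 ^ d)%N,
        forall lambda, lambda \in A :\ 0 -> Tr (p.[lambda] * q.[lambda]) = 1 &
        K = pq_arc p q A].

(* In characteristic 2 this says that a x^2 + h x y + b y^2 is irreducible. *)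
Definition irreducible_form (a h b : F) : Prop :=
  h != 0 /\ Tr (a * b / h ^+ 2) = 1.

Definition denniston_set (a h b : F) (A : {set F}) : {set 'M[F]_3} :=
  [set point u.1 u.2 1 | u : F * F &
    a * u.1 ^+ 2 + h * u.1 * u.2 + b * u.2 ^+ 2 \in A].

(* Field automorphisms map denniston_sets to denniston_sets, so linear
   equivalence gives the same class as semilinear equivalence. *)
Definition denniston (K : {set 'M[F]_3}) : Prop :=
  exists (a h b : F) (A : {set F}),
    [/\ irreducible_form a h b, zmod_closed A &
        projectively_equivalent (denniston_set a h b A) K].

Definition has_non_denniston_pq_arc (d : nat) : Prop :=
  exists K : {set 'M[F]_3},
    [/\ generated_by_pq_map d K, maximal_arc (2 ^ d) K & ~ denniston K].

End Arcs.

Definition is_largest (P : nat -> Prop) (d : nat) : Prop :=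
  P d /\ forall d', P d' -> (d' <= d)%N.

(* Main.v *)
Require Import Defs.
From mathcomp Require Import all_boot all_order all_algebra.
From mathcomp Require Import all_fingroup all_field.
From mathcomp Require Import ring zify.
From Stdlib Require Import Classical_Prop.

(** Write F for the field with 2 ^ m elements and n for the integral part of
    m / 2. A {p,q}-map on an additive subgroup A of order 2 ^ d amounts to two
    additive maps x p(x) and x q(x), and Mathon's condition says that
    Tr (p x * q x) = 1 on A minus 0. Mathon's theorem makes every such map give
    a maximal arc [pq_arc_maximal]: the trace of pq is almost additive under
    the composition of conics, which makes the conics disjoint and lets a line
    off the nucleus meet either none or half of them.

    Upper bound. If 2d >= m + 5, that is d >= n + 3, then p and q are affine
    functions on A [rigidity], and an affine map gives a pencil of conics that
    a shear carries to Denniston's [affine_denniston]. For rigidity, let K >= 2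
    be the largest index with (a_K, b_K) <> (0, 0). As the trace is invariant
    under squaring, Tr (p q) = Tr G for a polynomial G of degree at most
    2 ^ K - 1, and the coefficient of G at that degree is the value at
    (sqrt b_K, sqrt a_K) of the form a_0 X ^ 2 + X Y + b_0 Y ^ 2. Summing Tr G
    over A shows that Tr (a_0 b_0) = 1, so this form is anisotropic and it
    suffices that the leading coefficient c of G is 0.
    - If K <= d - 2 [top_vanish_low], summing Tr G over K-dimensional subgroups
      gives Tr (c det (z_i ^ (2 ^ r))) = 0 for all z_i in A. The m conjugates that
      make up the trace are multilinear in the coordinates of the z_i in a basis
      of A, so the relation holds for coordinates in F, and these can be chosen
      so that only the term of c itself remains, with a nonzero factor
      [moore_forms_free].
    - If K = d - 1 [sqr_coef_top], the sums over A of Tr G x * x ^ (1 + 2 ^ t)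
      vanish. The summands are conjugates of one bilinear form with three
      unknown coefficients, and three choices of t isolate these one after the
      other.

    Lower bound. The alternating form Tr (x ^ 2 y + x y ^ 2) has 1 in its
    radical, so it has a totally isotropic subgroup A of order 2 ^ (n + 1). On A
    the map Tr (x ^ 3) is additive, hence of the form Tr (c x)
    [cubic_trace_subgroup], and p = a_0 + c x + x ^ 3, q = 1 with Tr a_0 = 1
    satisfy Mathon's condition. If their arc were Denniston, each of its conics,
    parametrized by polynomials of degree 2, would give an equation of degree 4
    with more than 4 solutions for some conic of the pencil; so all the conics
    would lie in the pencil and p would be affine on A [denniston_affine], which
    the term x ^ 3 forbids. *)

Set Implicit Arguments.
Unset Strict Implicit.
Unset Printing Implicit Defensive.

Import GRing.Theory.
Local Open Scope ring_scope.

(** * The trace and additive subgroups in characteristic two *)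

Section CharacteristicTwo.
Variables (F : finFieldType) (m : nat).
Hypothesis hF : #|F| = (2 ^ m)%N.

Lemma pchar2F : 2 \in [pchar F].
Proof. exact: card_finPcharP hF _. Qed.

Lemma addrr_char2 (x : F) : x + x = 0.
Proof. exact: addrr_pchar2 pchar2F x. Qed.

Lemma oppr_char2 (x : F) : - x = x.
Proof. exact: oppr_pchar2 pchar2F x. Qed.

Lemma addr_eq0_char2 (x y : F) : (x + y == 0) = (x == y).
Proof. by rewrite addr_eq0 oppr_char2. Qed.

Lemma m_gt0 : (0 < m)%N.
Proof. by case: m hF => // h; have := finNzRing_gt1 F; rewrite h. Qed.

Lemma frobD i (x y : F) : (x + y) ^+ (2 ^ i) = x ^+ (2 ^ i) + y ^+ (2 ^ i).
Proof. by apply: exprDn_pchar; rewrite pnatX pnatE // pchar2F. Qed.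

Lemma sqrD (x y : F) : (x + y) ^+ 2 = x ^+ 2 + y ^+ 2.
Proof. exact: (frobD 1). Qed.

Lemma frob_sum i (I : Type) (r : seq I) (P : pred I) (f : I -> F) :
  (\sum_(j <- r | P j) f j) ^+ (2 ^ i) = \sum_(j <- r | P j) f j ^+ (2 ^ i).
Proof.
elim/big_rec2: _ => [|j y x _ <-]; first by rewrite expr0n expn_eq0.
exact: frobD.
Qed.

Lemma frob_period (x : F) i : x ^+ (2 ^ (i + m)) = x ^+ (2 ^ i).
Proof. by rewrite addnC expnD exprM -hF expf_card. Qed.

Lemma frob_inj i : injective (fun x : F => x ^+ (2 ^ i)).
Proof.
move=> x y /= e; apply/eqP; rewrite -addr_eq0_char2.
have : (x + y) ^+ (2 ^ i) == 0 by rewrite frobD e addrr_char2.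
by rewrite expf_eq0 => /andP [].
Qed.

Definition sqrt2 (x : F) : F := x ^+ (2 ^ m.-1).

Lemma sqrt2K (x : F) : sqrt2 x ^+ 2 = x.
Proof. by rewrite /sqrt2 -exprM -expnSr prednK ?m_gt0 // -hF expf_card. Qed.

Lemma TrE (x : F) : Tr x = \sum_(i < m) x ^+ (2 ^ i).
Proof. by rewrite /Tr hF pfactorK. Qed.

Lemma TrD (x y : F) : Tr (x + y) = Tr x + Tr y.
Proof. by rewrite !TrE -big_split; apply: eq_bigr => i _; apply: frobD. Qed.

Lemma Tr0 : Tr (0 : F) = 0.
Proof. by rewrite TrE big1 // => i _; rewrite expr0n expn_eq0. Qed.

Lemma Tr_sum (I : Type) (r : seq I) (P : pred I) (f : I -> F) :
  Tr (\sum_(j <- r | P j) f j) = \sum_(j <- r | P j) Tr (f j).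
Proof. by apply: (big_morph _ TrD Tr0). Qed.

Lemma Tr_sqr (x : F) : Tr (x ^+ 2) = Tr x.
Proof.
rewrite !TrE; have := m_gt0; case: m hF => // k hk _.
rewrite big_ord_recr big_ord_recl /= addrC; congr (_ + _).
  by rewrite -exprM -expnS -hk expf_card expr1.
by apply: eq_bigr => i _; rewrite -exprM -expnS.
Qed.

Lemma sqr_Tr (x : F) : Tr x ^+ 2 = Tr x.
Proof.
rewrite -{2}Tr_sqr !TrE (frob_sum 1); apply: eq_bigr => i _.
by rewrite -!exprM mulnC.
Qed.

Lemma Tr01 (x : F) : Tr x = 0 \/ Tr x = 1.
Proof.
have /eqP := sqr_Tr x; rewrite -addr_eq0_char2 expr2 -{3}[Tr x]mulr1 -mulrDr mulf_eq0.
by rewrite addr_eq0_char2 => /orP [] /eqP; [left | right].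
Qed.

Lemma Tr_nonzero : exists x : F, Tr x = 1.
Proof.
have [/existsP [x /eqP hx]|/existsPn h] := boolP [exists x : F, Tr x == 1].
  by exists x.
pose p : {poly F} := \sum_(i < m) 'X^(2 ^ i).
have szp : (size p <= 2 ^ m.-1 + 1)%N.
  apply: (leq_trans (size_sum _ _ _)); apply/bigmax_leqP => i _.
  by rewrite size_polyXn addn1 ltnS leq_exp2l // -ltnS prednK ?m_gt0.
have hp x : p.[x] = Tr x.
  by rewrite TrE horner_sum; apply: eq_bigr => i _; rewrite hornerXn.
have p0 : p != 0.
  apply/eqP => /(congr1 (fun q : {poly F} => q`_1)) /eqP.
  rewrite coef_sum coef0; have := m_gt0; case: m hF => // k _ _.
  rewrite big_ord_recl big1 ?addr0 ?coefXn ?oner_eq0 // => i _.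
  by rewrite coefXn /= -{1}(expn0 2) eqn_exp2l.
have := max_poly_roots p0 _ (enum_uniq F).
have -> : all (root p) (enum F).
  apply/allP => x _; rewrite /root hp; case: (Tr01 x) => e.
    by rewrite e.
  by have := h x; rewrite e eqxx.
move=> /(_ isT); rewrite -cardE hF => /leq_trans /(_ szp).
rewrite addn1 ltnS leq_exp2l //; have := m_gt0; lia.
Qed.

Lemma Tr_nondeg (a : F) : a != 0 -> exists x, Tr (a * x) = 1.
Proof.
by move=> a0; have [x hx] := Tr_nonzero; exists (a^-1 * x); rewrite mulVKf.
Qed.

(** Dividing by y ^ 2 turns a zero into a solution s = a x / y of
    s ^ 2 + s = a b, and s ^ 2 and s have the same trace. *)
Lemma trace_one_anisotropic (a b x y : F) : Tr (a * b) = 1 ->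
  a * x ^+ 2 + x * y + b * y ^+ 2 = 0 -> x = 0 /\ y = 0.
Proof.
move=> hab e.
have [y0|y0] := eqVneq y 0.
  split=> //; move: e; rewrite y0 expr0n /= !mulr0 !addr0 => /eqP.
  rewrite mulf_eq0 sqrf_eq0 => /orP [/eqP a0|/eqP //].
  by move: hab; rewrite a0 mul0r Tr0 => /eqP; rewrite eq_sym oner_eq0.
suff : Tr (a * b) = 0 by rewrite hab => /eqP; rewrite oner_eq0.
have -> : a * b = (a * x / y) ^+ 2 + (a * x / y).
  apply/eqP; rewrite -addr_eq0_char2; apply/eqP.
  have -> : a * b + ((a * x / y) ^+ 2 + a * x / y) =
     a / y ^+ 2 * (a * x ^+ 2 + x * y + b * y ^+ 2) by field.
  by rewrite e mulr0.
by rewrite TrD Tr_sqr addrr_char2.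
Qed.

Lemma subgroup0 (A : {set F}) : zmod_closed A -> 0 \in A.
Proof. by case. Qed.

Lemma subgroupD (A : {set F}) x y : zmod_closed A -> x \in A -> y \in A -> x + y \in A.
Proof. by case=> _ h hx hy; rewrite -(oppr_char2 y); apply: h. Qed.

Lemma subgroup_char2 (A : {set F}) :
  0 \in A -> (forall x y, x \in A -> y \in A -> x + y \in A) -> zmod_closed A.
Proof. by move=> h0 hD; split=> // x y hx hy; rewrite oppr_char2; apply: hD. Qed.

Lemma sum_subgroup_shift (A : {set F}) (R : nmodType) (f : F -> R) v : zmod_closed A -> v \in A ->
  \sum_(x in A) f (x + v) = \sum_(x in A) f x.
Proof.
move=> hA hv; rewrite [RHS](reindex_inj (addIr v)) /=; apply: eq_bigl => x.
apply/idP/idP => [hx|/(subgroupD hA hv)]; first exact: subgroupD hA _ _.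
by rewrite addrC -addrA addrr_char2 addr0.
Qed.

(** Lagrange interpolation of g at the points of A: the denominator at a point
    a is the product of the a - b for b <> a, and translation by a makes it the
    product of the nonzero elements of A for every a. *)
Lemma sum_subgroup (A : {set F}) (g : {poly F}) : zmod_closed A ->
  (size g <= #|A|)%N ->
  \sum_(x in A) g.[x] = (\prod_(x in A :\ 0) x) * g`_(#|A|.-1).
Proof.
move=> hA szg; set M := \prod_(x in A :\ 0) x.
pose lag a : {poly F} := \prod_(b <- enum (A :\ a)) ('X - b%:P).
have cA1 a : a \in A -> #|A :\ a| = #|A|.-1 by move=> ha; rewrite (cardsD1 a A) ha.
have szl a : a \in A -> size (lag a) = #|A|.
  move=> ha; rewrite size_prod_XsubC -cardE cA1 //.
  by rewrite prednK // (cardsD1 a) ha.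
have Mlag a : a \in A -> (lag a).[a] = M.
  move=> ha; rewrite /lag horner_prod big_enum_cond /= /M.
  rewrite [RHS](reindex_inj (addrI a)) /=; apply: eq_big => [x|x _].
    rewrite !inE andbT addr_eq0_char2 [a == x]eq_sym.
    rewrite ?andbT; congr (_ && _); apply/idP/idP => hx; first exact: subgroupD hA _ _.
    by rewrite -[x](addKr a) oppr_char2; apply: subgroupD hA _ _.
  by rewrite hornerXsubC oppr_char2.
pose h := \sum_(a in A) g.[a] *: lag a - M *: g.
have szh : (size h <= #|A|)%N.
  rewrite (leq_trans (size_polyD _ _)) // geq_max size_polyN.
  rewrite (leq_trans (size_scale_leq _ _)) // andbT.
  apply: (leq_trans (size_sum _ _ _)); apply/bigmax_leqP => a ha.
  by rewrite (leq_trans (size_scale_leq _ _)) // szl.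
have h0 : h = 0.
  apply/eqP; apply/negPn/negP => hn0.
  suff hall : all (root h) (enum A).
    by have := max_poly_roots hn0 hall (enum_uniq A); rewrite -cardE ltnNge szh.
  apply/allP => b; rewrite mem_enum => hb; rewrite /root hornerD hornerN.
  rewrite horner_sum (bigD1 b) //= big1 ?addr0; last first.
    move=> a /andP [ha nab]; rewrite hornerZ /lag horner_prod.
    rewrite (bigD1_seq b) ?enum_uniq //=; last by rewrite mem_enum !inE hb eq_sym nab.
    by rewrite hornerXsubC subrr mul0r mulr0.
  by rewrite !hornerZ Mlag // mulrC subrr.
have /(congr1 (fun q : {poly F} => q`_(#|A|.-1))) := h0.
rewrite coef0 coefD coefN coefZ coef_sum => /eqP; rewrite subr_eq0 => /eqP <-.
apply: eq_bigr => a ha; rewrite coefZ -{1}(szl a ha).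
have /monicP : lag a \is monic by apply: monic_prod_XsubC.
by rewrite lead_coefE => ->; rewrite mulr1.
Qed.

Lemma prod_nonzero (A : {set F}) : \prod_(x in A :\ 0) x != 0.
Proof. by apply/prodf_neq0 => x; rewrite !inE => /andP []. Qed.

Definition trace_perp (A : {set F}) : {set F} := [set y | [forall x in A, Tr (x * y) == 0]].

Lemma trace_perpP (A : {set F}) y :
  reflect (forall x, x \in A -> Tr (x * y) = 0) (y \in trace_perp A).
Proof. by rewrite inE; apply: (iffP forall_inP) => h x hx; apply/eqP/h. Qed.

Lemma subgroup_trace_perp (A : {set F}) : zmod_closed (trace_perp A).
Proof.
apply: subgroup_char2 => [|y z /trace_perpP hy /trace_perpP hz]; apply/trace_perpP => x hx.
  by rewrite mulr0 Tr0.
by rewrite mulrDr TrD hy // hz // addrr_char2.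
Qed.

Lemma character_sum (A : {set F}) (chi : F -> F) : zmod_closed A ->
  (forall x, x \in A -> chi x = 0 \/ chi x = 1) ->
  (forall x y, x \in A -> y \in A -> chi (x + y) = chi x + chi y) ->
  (exists2 v, v \in A & chi v = 1) ->
  \sum_(x in A) (-1) ^+ (chi x != 0) = 0 :> int.
Proof.
move=> hA h01 hD [v hv chiv]; set S := \sum_(x in A) _.
have : S = - S.
  rewrite /S -[LHS](sum_subgroup_shift _ hA hv) -sumrN; apply: eq_bigr => x hx.
  rewrite hD // chiv; case: (h01 x hx) => ->; rewrite ?add0r ?oner_eq0 ?eqxx //=.
  by rewrite addrr_char2 eqxx.
lia.
Qed.

(** Both sides count the sum of the signs of Tr (x y) over x in A and y in F:
    a nonzero character sums to 0. *)
Lemma card_trace_perp (A : {set F}) : zmod_closed A -> (#|A| * #|trace_perp A|)%N = #|F|.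
Proof.
move=> hA; apply/eqP; rewrite -eqz_nat; apply/eqP.
pose ch (x : F) : int := (-1) ^+ (Tr x != 0).
transitivity (\sum_(y : F) \sum_(x in A) ch (x * y)).
  rewrite (bigID [pred y | y \in trace_perp A]) /= [X in _ + X]big1 ?addr0.
    rewrite (eq_bigr (fun _ => (#|A| : int))) => [|y /trace_perpP hy].
      by rewrite sumr_const PoszM -mulr_natr mulrC natz mulrC mulrC; lia.
    rewrite (eq_bigr (fun _ => 1)) ?sumr_const ?natz // => x hx.
    by rewrite /ch hy // eqxx.
  move=> y; rewrite inE => /forall_inPn /= [v hv Tv].
  apply: (@character_sum A (fun x => Tr (x * y))) => //.
  - by move=> x _; apply: Tr01.
  - by move=> x z _ _; rewrite mulrDl TrD.
  - by exists v => //; case: (Tr01 (v * y)) Tv => // ->; rewrite eqxx.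
rewrite exchange_big /= (bigD1 0) ?subgroup0 //= [X in _ + X]big1 ?addr0.
  rewrite (eq_bigr (fun _ => 1)) => [|x _]; last by rewrite /ch mul0r Tr0 eqxx.
  by rewrite sumr_const natz cardE.
move=> x /andP [_ x0].
transitivity (\sum_(y in [set: F]) ch (x * y)); first by apply: eq_bigl => y; rewrite inE.
apply: (@character_sum _ (fun y => Tr (x * y))).
- by apply: subgroup_char2 => *; rewrite inE.
- by move=> *; apply: Tr01.
- by move=> *; rewrite mulrDr TrD.
- by have [y hy] := Tr_nondeg x0; exists y; rewrite ?inE.
Qed.

(** The kernel B of chi has a larger orthogonal than A, by
    [card_trace_perp]; an element of the difference induces a nonzero character
    of A vanishing on B, and there is only one. *)
Lemma trace_represent (A : {set F}) (chi : F -> F) : zmod_closed A ->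
  (forall x, x \in A -> chi x = 0 \/ chi x = 1) ->
  (forall x y, x \in A -> y \in A -> chi (x + y) = chi x + chi y) ->
  exists a, forall x, x \in A -> chi x = Tr (a * x).
Proof.
move=> hA h01 hD.
have [/forall_inP h|/forall_inPn [v hv cv]] := boolP [forall x in A, chi x == 0].
  by exists 0 => x hx; rewrite mul0r Tr0; apply/eqP/h.
pose B := [set x in A | chi x == 0].
have chi0 : chi 0 = 0.
  by have := hD 0 0 (subgroup0 hA) (subgroup0 hA); rewrite addr0 addrr_char2.
have hB : zmod_closed B.
  apply: subgroup_char2 => [|x y]; rewrite !inE; first by rewrite subgroup0 ?chi0 ?eqxx.
  move=> /andP [hx /eqP ex] /andP [hy /eqP ey].
  by rewrite subgroupD // hD // ex ey addrr_char2 eqxx.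
have BA : (#|B| < #|A|)%N.
  apply/proper_card/properP; split; first by apply/subsetP => x; rewrite inE => /andP [].
  by exists v => //; rewrite inE hv.
have : ~~ (trace_perp B \subset trace_perp A).
  apply/negP => /subset_leq_card h.
  have := leq_mul BA h; rewrite mulSn.
  have : (0 < #|trace_perp B|)%N by apply/card_gt0P; exists 0; apply: subgroup0 (subgroup_trace_perp B).
  by have := card_trace_perp hA; have := card_trace_perp hB; lia.
move=> /subsetPn [a /trace_perpP haB /trace_perpP haA].
have aA : exists2 w, w \in A & Tr (w * a) = 1.
  have [/forall_inP h|/forall_inPn [w hw Tw]] := boolP [forall x in A, Tr (x * a) == 0].
    by case: haA => x hx; apply/eqP/h.
  by exists w => //; case: (Tr01 (w * a)) Tw => // ->; rewrite eqxx.
case: aA => w hw Tw; exists a => x hx; rewrite mulrC.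
have cw : chi w = 1.
  case: (h01 w hw) => // cw0; have := haB w; rewrite inE hw cw0 eqxx Tw => /(_ isT) /eqP.
  by rewrite oner_eq0.
case: (h01 x hx) => cx; first by rewrite cx haB // inE hx cx eqxx.
have := haB (x + w); rewrite inE subgroupD // hD // cx cw addrr_char2 eqxx => /(_ isT).
by rewrite mulrDl TrD Tw => /eqP; rewrite addr_eq0_char2 => /eqP ->.
Qed.

End CharacteristicTwo.

(** * Moore determinants and bases of additive subgroups *)

Section Moore.
Variables (F : finFieldType) (m : nat).
Hypothesis hF : #|F| = (2 ^ m)%N.

Lemma det_char2 n (B : 'M[F]_n) : \det B = \sum_(s : 'S_n) \prod_i B i (s i).
Proof. by apply: eq_bigr => s _; rewrite (oppr_char2 hF) expr1n mul1r. Qed.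

Lemma frob_det n (B : 'M[F]_n) s :
  (\det B) ^+ (2 ^ s) = \det (map_mx (fun x => x ^+ (2 ^ s)) B).
Proof.
rewrite !det_char2 (frob_sum hF); apply: eq_bigr => u _.
by rewrite -prodrXl; apply: eq_bigr => i _; rewrite mxE.
Qed.

(** Multilinearity of the determinant in the rows of T X: an identity for the
    determinants of rows of X, repetitions included, extends to all linear
    combinations of these rows. *)
Lemma det_mul_rect K n (T : 'M[F]_(K, n)) (X : 'M[F]_(n, K)) :
  \det (T *m X) = \sum_(g : {ffun 'I_K -> 'I_n})
    (\prod_i T i (g i)) * \det (\matrix_(i, r) X (g i) r).
Proof.
rewrite det_char2.
under [RHS]eq_bigr do rewrite det_char2 mulr_sumr.
rewrite exchange_big; apply: eq_bigr => s _ /=.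
under eq_bigr do rewrite mxE.
rewrite bigA_distr_bigA; apply: eq_bigr => g _ /=.
by rewrite big_split; congr (_ * _); apply: eq_bigr => i _; rewrite mxE.
Qed.

(** Complementing i pairs off the subsets. *)
Lemma sum_toggle (T : finType) (h : {set T} -> F) (i : T) :
  (forall I : {set T}, i \notin I -> h (i |: I) = h I) -> \sum_(I : {set T}) h I = 0.
Proof.
move=> hh; rewrite (bigID (fun I : {set T} => i \in I)) /=.
rewrite (reindex_onto (fun I : {set T} => i |: I) (fun I => I :\ i)) /=; last first.
  by move=> I iI; rewrite setD1K.
rewrite (eq_big (fun I : {set T} => i \notin I) h) ?(addrr_char2 hF) // => [I|I /andP [_ /eqP <-]].
  rewrite setU11 /=; apply/eqP/idP => [<-|iI]; first by rewrite !inE eqxx.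
  by rewrite setU1K.
by rewrite hh ?setD1K ?inE ?eqxx //; rewrite setU1K // !inE eqxx.
Qed.

(** The exponent is the sum of the 2 ^ r, so the power is a product of K
    additive functions. In its expansion the monomial attached to a map g of the
    indices occurs once for each I containing the image of g, an even number of
    times unless g is a permutation. *)
Lemma sum_subsets_moore K (z : 'I_K -> F) :
  \sum_(I : {set 'I_K}) (\sum_(i in I) z i) ^+ (2 ^ K - 1)
  = \det (\matrix_(i, r < K) z i ^+ (2 ^ r)).
Proof.
have e2 : (2 ^ K - 1 = \sum_(r < K) 2 ^ r)%N by rewrite subn1 predn_exp mul1n.
under eq_bigr => I _.
  rewrite e2 -prodrXr.
  under eq_bigr do rewrite (frob_sum hF) big_mkcond.
  rewrite bigA_distr_bigA /=.
  over.
rewrite exchange_big /= -det_tr det_char2 /=.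
rewrite (bigID (fun f : {ffun 'I_K -> 'I_K} => injectiveb f)) /= [X in _ + X]big1 ?addr0.
  rewrite (reindex (@pval _)) /=; last first.
    have [i i_inj] : exists i : 'I_K -> 'I_K, injective i by exists id.
    pose in_Sn := insubd (1%g : 'S_K).
    by exists in_Sn => /= f Uf; first apply: val_inj; apply: insubdK.
  apply: eq_big => [s|s _]; first by rewrite (valP s).
  rewrite (bigD1 setT) //= [X in _ + X]big1 ?addr0; last first.
    move=> I; rewrite -subTset => /subsetPn [i _ iI].
    have e : pval s (s^-1 i)%g = i by rewrite pvalE permKV.
    by rewrite (bigD1 (s^-1 i)%g) //= e (negbTE iI) mul0r.
  by apply: eq_bigr => i _; rewrite !mxE inE pvalE.
move=> f /injectiveP ninj.
have : [exists i, i \notin codom f].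
  apply/existsPn; move=> h; apply: ninj; apply/injectiveP.
  have /card_uniqP : #|codom f| = size (codom f); last by [].
  by rewrite size_codom; apply: eq_card => i; have := h i; rewrite negbK => ->.
move=> /existsP [i hi]; apply: (@sum_toggle _ _ i) => I iI.
apply: eq_bigr => r _; rewrite !inE.
suff /negbTE -> : f r != i by [].
by apply: contraNneq hi => <-; apply: codom_f.
Qed.

(** A basis of A over the field with two elements, given by its subset sums. *)
Lemma subgroup_basis (A : {set F}) d : zmod_closed A -> #|A| = (2 ^ d)%N ->
  exists l : 'I_d -> F,
    injective (fun I : {set 'I_d} => \sum_(i in I) l i) /\
    A = [set \sum_(i in I) l i | I : {set 'I_d}].
Proof.
move=> hA cA.
have hsum k (l : 'I_k -> F) (I : {set 'I_k}) : (forall i, l i \in A) -> \sum_(i in I) l i \in A.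
  move=> h; apply: (big_ind (fun x => x \in A)) => [||i _]; [exact: subgroup0|move=> x y; exact: (subgroupD hF)|exact: h].
suff /(_ d (leqnn d)) [l hl il] : forall n, (n <= d)%N ->
    exists2 l : 'I_n -> F, (forall i, l i \in A) &
    injective (fun I : {set 'I_n} => \sum_(i in I) l i).
  exists l; split=> //; apply/eqP; rewrite eq_sym eqEcard card_imset // -cardsT.
  rewrite -powersetT card_powerset cardsT card_ord cA leqnn andbT.
  by apply/subsetP => x /imsetP [I _ ->]; apply: hsum.
elim=> [_|k IH kd].
  exists (fun _ => 0) => [[]//|I J _]; by apply/setP => [[]].
have [l hl il] := IH (ltnW kd).
have : ~~ (A \subset [set \sum_(i in I) l i | I : {set 'I_k}]).
  apply/negP => /subset_leq_card; rewrite card_imset // -cardsT.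
  rewrite -powersetT card_powerset cardsT card_ord cA leq_exp2l //; lia.
move=> /subsetPn [v vA /imsetP vn].
have {}vn (I : {set 'I_k}) : v != \sum_(i in I) l i by apply: contra_notN vn => /eqP ->; exists I.
exists (fun i => if unlift ord0 i is Some j then l j else v) => [i|I J].
  by case: unliftP.
have red (I0 : {set 'I_k.+1}) :
    \sum_(i in I0) (if unlift ord0 i is Some j then l j else v) =
    (if ord0 \in I0 then v else 0) + \sum_(j in [set j | lift ord0 j \in I0]) l j.
  rewrite big_mkcond big_ord_recl unlift_none; congr (_ + _).
  rewrite [RHS]big_mkcond; apply: eq_bigr => j _; by rewrite liftK inE.
have key (I0 J0 : {set 'I_k}) : v + \sum_(i in I0) l i = \sum_(i in J0) l i -> False.
  move=> e; have := vn ((I0 :\: J0) :|: (J0 :\: I0)); apply/negP; rewrite negbK.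
  rewrite -(addr_eq0_char2 hF) big_mkcond /=.
  have -> : v = \sum_(i in I0) l i + \sum_(i in J0) l i.
    by rewrite -e addrCA (addrr_char2 hF) addr0.
  rewrite !(big_mkcond (fun i => i \in _)) -!big_split big1 //= => i _.
  rewrite !inE; case: (i \in I0); case: (i \in J0) => /=;
    by rewrite ?addr0 ?add0r ?(addrr_char2 hF).
rewrite !red => e; apply/setP => i.
have e2 : [set j | lift ord0 j \in I] = [set j | lift ord0 j \in J] /\
          (ord0 \in I) = (ord0 \in J).
  move: e; case: (ord0 \in I); case: (ord0 \in J); rewrite ?add0r.
  - by move=> /addrI /il.
  - by move=> /key.
  - by move=> /esym /key.
  - by move=> /il.
case: (unliftP ord0 i) => [j|] ->; last by case: e2.
by case: e2 => /setP /(_ j); rewrite !inE.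
Qed.
End Moore.

(** * Frobenius powers of a basis *)

Section Windows.
Variables (F : finFieldType) (m d : nat) (A : {set F}) (l : 'I_d -> F).
Hypothesis hF : #|F| = (2 ^ m)%N.
Hypothesis cA : #|A| = (2 ^ d)%N.
Hypothesis Al : A = [set \sum_(i in I) l i | I : {set 'I_d}].

Lemma d_le_m : (d <= m)%N.
Proof. by rewrite -(@leq_exp2l 2) // -cA -hF max_card. Qed.

(** A relation between d consecutive Frobenius powers on A is a polynomial of
    degree at most 2 ^ (d - 1) with 2 ^ d roots. *)
Lemma window_free (c : 'I_d -> F) t :
  (forall x, x \in A -> \sum_(r < d) c r * x ^+ (2 ^ (t + r)) = 0) -> forall r, c r = 0.
Proof.
move=> h; pose q : {poly F} := \sum_(r < d) c r *: 'X^(2 ^ r).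
have cq r : q`_(2 ^ r) = if insub r is Some i then c i else 0.
  rewrite coef_sum; case: insubP => [i _ <-|ri].
    rewrite (bigD1 i) //= coefZ coefXn eqxx mulr1 big1 ?addr0 // => j ji.
    by rewrite coefZ coefXn eqn_exp2l // eq_sym (inj_eq val_inj) (negbTE ji) mulr0.
  rewrite big1 // => j _; rewrite coefZ coefXn eqn_exp2l //.
  have /negbTE -> : r != j by apply: contraNneq ri => ->; apply: ltn_ord.
  by rewrite mulr0.
suff q0 : q = 0.
  by move=> r; have := cq r; rewrite q0 coef0 valK.
apply/eqP; apply/negPn/negP => qn0.
have szq : (size q <= 2 ^ d.-1 + 1)%N.
  apply: (leq_trans (size_sum _ _ _)); apply/bigmax_leqP => i _.
  rewrite (leq_trans (size_scale_leq _ _)) // size_polyXn addn1 ltnS leq_exp2l //.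
  by have := ltn_ord i; lia.
pose s := [seq x ^+ (2 ^ t) | x <- enum A].
have us : uniq s by rewrite map_inj_uniq ?enum_uniq //; apply: frob_inj hF _.
have rs : all (root q) s.
  apply/allP => _ /mapP [x xA ->]; rewrite mem_enum in xA.
  rewrite /root horner_sum -[X in _ == X](h x xA); apply/eqP; apply: eq_bigr => r _.
  by rewrite hornerZ hornerXn -exprM -expnD.
have := max_poly_roots qn0 rs us; rewrite size_map -cardE cA => /leq_trans /(_ szq).
have d0 : (0 < d)%N.
  by rewrite lt0n; apply: contraNneq qn0 => e; rewrite /q big1 // => i _; have := ltn_ord i; rewrite [X in (_ < X)%N]e.
have : (0 < 2 ^ d.-1)%N by rewrite expn_gt0.
by rewrite -{2}(prednK d0) expnS; lia.
Qed.

Lemma additive_ext (f : F -> F) : f 0 = 0 -> (forall x y, f (x + y) = f x + f y) ->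
  (forall j, f (l j) = 0) -> forall x, x \in A -> f x = 0.
Proof.
move=> f0 fD h x; rewrite Al => /imsetP [I _ ->].
by rewrite (big_morph f fD f0) big1.
Qed.

Lemma window_combD (c : 'I_d -> F) (t : nat) x y :
  \sum_(r < d) c r * (x + y) ^+ (2 ^ (t + r)) =
  \sum_(r < d) c r * x ^+ (2 ^ (t + r)) + \sum_(r < d) c r * y ^+ (2 ^ (t + r)).
Proof. by rewrite -big_split; apply: eq_bigr => r _; rewrite (frobD hF) mulrDr. Qed.

Definition window t : 'M[F]_d := \matrix_(j, r) l j ^+ (2 ^ (t + r)).

Lemma window_unit t : window t \in unitmx.
Proof.
rewrite -unitmx_tr unitmxE unitfE; apply/negP => /det0P [v vn0 hv].
have {}vn0 : v != 0 by [].
case/eqP: vn0; apply/rowP => r; rewrite mxE.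
apply: (@window_free (v 0) t _ r); apply: additive_ext => [||j].
- by rewrite big1 // => i _; rewrite expr0n expn_eq0 mulr0.
- by move=> x y; apply: window_combD.
have /rowP /(_ j) := hv; rewrite !mxE => hj; rewrite -[RHS]hj; apply: eq_bigr => i _.
by rewrite !mxE.
Qed.

(** Consequently x ^ (2 ^ o) reduces on A to the first d Frobenius powers. *)
Lemma window_expand o : exists v : 'I_d -> F,
  forall x, x \in A -> x ^+ (2 ^ o) = \sum_(r < d) v r * x ^+ (2 ^ r).
Proof.
pose w := invmx (window 0) *m \col_j (l j ^+ (2 ^ o)).
exists (fun r => w r 0) => x xA; apply/eqP; rewrite -(addr_eq0_char2 hF); apply/eqP; move: x xA.
apply: additive_ext => [|x y|j].
- by rewrite expr0n expn_eq0 add0r big1 // => i _; rewrite expr0n expn_eq0 mulr0.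
- by rewrite (frobD hF) (window_combD _ 0) addrACA.
apply/eqP; rewrite (addr_eq0_char2 hF); apply/eqP.
have /colP /(_ j) : window 0 *m w = \col_j (l j ^+ (2 ^ o)) by rewrite mulKVmx ?window_unit.
rewrite !mxE => <-; apply: eq_bigr => r _; by rewrite mxE mulrC.
Qed.

(** The linear form phi on F ^ d evaluated at the vector of the powers
    l_j ^ (2 ^ t). By [window_unit] any d consecutive such vectors form a basis,
    and they repeat with period m in t. *)
Definition pairing (phi : 'rV[F]_d) t : F := \sum_j phi 0 j * l j ^+ (2 ^ t).

Lemma pairing_period phi t : pairing phi (t + m) = pairing phi t.
Proof. by apply: eq_bigr => j _; rewrite (frob_period hF). Qed.

Lemma pairing_window phi t (r : 'I_d) : pairing phi (t + r) = (phi *m window t) 0 r.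
Proof. by rewrite mxE; apply: eq_bigr => j _; rewrite mxE. Qed.

Lemma pairing_eq0 phi t : (forall r, (r < d)%N -> pairing phi (t + r) = 0) -> phi = 0.
Proof.
move=> h; apply: (can_inj (mulmxK (window_unit t))); rewrite mul0mx.
by apply/rowP => r; rewrite [RHS]mxE -pairing_window h.
Qed.

Lemma pairing_interp t (w : 'I_d -> F) : exists phi, forall r : 'I_d, pairing phi (t + r) = w r.
Proof.
exists (\row_r w r *m invmx (window t)) => r.
by rewrite pairing_window mulmxKV ?window_unit // mxE.
Qed.

Lemma pairing_zeros (s : seq nat) : (size s < d)%N ->
  exists2 phi, phi != 0 & forall t, t \in s -> pairing phi t = 0.
Proof.
move=> hs; pose N := \matrix_(j < d, k < size s) l j ^+ (2 ^ nth 0%N s k).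
have : kermx N != 0.
  rewrite kermx_eq0 -row_leq_rank -ltnNge (leq_ltn_trans (rank_leq_col _)) //.
move=> /rowV0Pn [phi /sub_kermxP hphi phi0]; exists phi => // t ts.
have it : (index t s < size s)%N by rewrite index_mem.
have /rowP /(_ (Ordinal it)) := hphi; rewrite !mxE => <-.
by apply: eq_bigr => j _; rewrite !mxE /= nth_index.
Qed.

End Windows.

Section MooreForms.
Variables (F : finFieldType) (m d : nat) (A : {set F}) (l : 'I_d -> F).
Hypothesis hF : #|F| = (2 ^ m)%N.
Hypothesis cA : #|A| = (2 ^ d)%N.
Hypothesis Al : A = [set \sum_(i in I) l i | I : {set 'I_d}].
Local Notation pairing := (pairing l).

(** The idea is to choose the rows of Th so that every term with s <> 0 has a
    zero row or a zero column. All rows vanish at the exponents -1 and K, which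
    gives a zero column as soon as the window from s to s + K - 1 contains one of
    these modulo m. The other windows with s <> 0 lie between K + 1 and m - 2.
    One row phi1 vanishes from K to d + K - 3 and another row phi2 from m - d + 3
    to m - 1; as 2 d >= m + 4, each of these windows lies in one of the two
    ranges. Both rows exist, being subject to d - 1 conditions each, and they
    cannot vanish on the window of s = 0, since they would then vanish on d
    consecutive exponents. The remaining rows are dual to the window of s = 0. *)
Lemma moore_forms_free K (c : F) : (2 <= K)%N -> (K + 2 <= d)%N -> (m + 4 <= 2 * d)%N ->
  (forall Th : 'M[F]_(K, d),
    \sum_(s < m) c ^+ (2 ^ s) * \det (\matrix_(i, r < K) pairing (row i Th) (s + r)) = 0) ->
  c = 0.
Proof.
move=> K2 Kd md hT; have dm := d_le_m hF cA.
have ev_per phi t : (m <= t)%N -> pairing phi t = pairing phi (t - m).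
  by move=> mt; rewrite -{1}(subnK mt) (pairing_period _ hF).
(* m.-1 stands for the exponent -1 *)
have [phi1 phi1n0 z1] : exists2 phi, phi != 0 &
    forall t, t \in m.-1 :: iota K (d - 2) -> pairing phi t = 0.
  by apply: pairing_zeros; rewrite /= size_iota; lia.
have z1' t : (K <= t <= d + K - 3)%N -> pairing phi1 t = 0.
  by move=> ht; apply: z1; rewrite inE mem_iota; apply/orP; right; lia.
have [r1 ev1] : exists r : 'I_K, pairing phi1 r != 0.
  apply/existsP; apply: contraR phi1n0 => /existsPn h; apply/eqP.
  apply: (pairing_eq0 hF cA Al (t := m.-1)) => r rd.
  case: r rd => [|r] rd; first by rewrite addn0 z1 // inE eqxx.
  rewrite ev_per; last by lia.
  have -> : (m.-1 + r.+1 - m = r)%N by have := m_gt0 hF; lia.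
  case: (ltnP r K) => rK; last by apply: z1'; lia.
  by have := h (Ordinal rK); rewrite negbK => /eqP.
(* vanishing at r1 as well makes the rows phi1 and phi2 triangular *)
have [phi2 phi2n0 z2] : exists2 phi, phi != 0 &
    forall t, t \in (K : nat) :: (r1 : nat) :: iota (m - d + 3) (d - 3) -> pairing phi t = 0.
  by apply: pairing_zeros; rewrite /= size_iota; lia.
have z2' t : (m - d + 3 <= t <= m.-1)%N -> pairing phi2 t = 0.
  by move=> ht; apply: z2; rewrite !inE mem_iota; do 2 (apply/orP; right); lia.
have [r2 ev2] : exists r : 'I_K, pairing phi2 r != 0.
  apply/existsP; apply: contraR phi2n0 => /existsPn h; apply/eqP.
  apply: (pairing_eq0 hF cA Al (t := (m - d + 3)%N)) => r rd.
  case: (ltnP r (d - 3)) => rd3; first by apply: z2'; lia.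
  rewrite ev_per; last by lia.
  case: (ltnP (m - d + 3 + r - m) K) => rK; last first.
    have -> : (m - d + 3 + r - m = K)%N by lia.
    by apply: z2; rewrite inE eqxx.
  by have := h (Ordinal rK); rewrite negbK => /eqP.
have r12 : r2 != r1.
  by apply: contraNneq ev2 => ->; apply/eqP/z2; rewrite !inE eqxx orbT.
have hpsi (i : 'I_K) : exists phi, forall r : 'I_d, pairing phi (m.-1 + r) = ((r : nat) == i.+1)%:R.
  exact: (pairing_interp hF cA Al m.-1 (fun r : 'I_d => ((r : nat) == i.+1)%:R)).
have [psi hpsi'] : exists psi : 'I_K -> 'rV[F]_d, forall i (r : 'I_d),
    pairing (psi i) (m.-1 + r) = ((r : nat) == i.+1)%:R.
  have [f hf] := fin_all_exists hpsi; by exists f.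
have psi_last i : pairing (psi i) m.-1 = 0.
  have d0 : (0 < d)%N by lia.
  by have := hpsi' i (Ordinal d0); rewrite addn0.
have psi_ev i t : (t <= K)%N -> pairing (psi i) t = (t == i :> nat)%:R.
  move=> tK; have td : (t.+1 < d)%N by lia.
  have := hpsi' i (Ordinal td); rewrite /= eqSS => <-.
  rewrite [RHS]ev_per; last by lia.
  by congr (pairing _ _); have := m_gt0 hF; lia.
pose Th : 'M[F]_(K, d) :=
  \matrix_i (if i == r1 then phi1 else if i == r2 then phi2 else psi i).
have rTh i : row i Th = if i == r1 then phi1 else if i == r2 then phi2 else psi i.
  by rewrite rowK.
have Tlast i : pairing (row i Th) m.-1 = 0.
  rewrite rTh; case: ifP => _; first by apply: z1; rewrite inE eqxx.
  by case: ifP => _ //; apply: z2'; have := m_gt0 hF; lia.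
have TK i : pairing (row i Th) K = 0.
  rewrite rTh; case: ifP => _; first by apply: z1'; lia.
  case: ifP => _; first by apply: z2; rewrite inE eqxx.
  by rewrite psi_ev //; have /gtn_eqF -> := ltn_ord i.
have := hT Th; rewrite (bigD1 (Ordinal (m_gt0 hF))) //= expr1 big1 ?addr0; last first.
  move=> s /eqP /= s0.
  have {}s0 : (s != 0 :> nat) by apply/eqP => h; apply: s0; apply: val_inj.
  have sm := ltn_ord s; rewrite [\det _](_ : _ = 0) ?mulr0 //.
  have col0 (r : 'I_K) : (forall i, pairing (row i Th) (s + r) = 0) ->
      \det (\matrix_(i, r < K) pairing (row i Th) (s + r)) = 0.
    move=> h; rewrite (expand_det_col _ r) big1 // => i _.
    by rewrite mxE h mul0r.
  have row0 (i : 'I_K) : (forall r : 'I_K, pairing (row i Th) (s + r) = 0) ->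
      \det (\matrix_(i, r < K) pairing (row i Th) (s + r)) = 0.
    move=> h; rewrite (expand_det_row _ i) big1 // => r _.
    by rewrite mxE h mul0r.
  case: (leqP s K) => sK.
    have h : (K - s < K)%N by lia.
    by apply: (col0 (Ordinal h)) => i /=; rewrite subnKC.
  case: (leqP (m - K) s) => smK.
    have h : (m.-1 - s < K)%N by lia.
    by apply: (col0 (Ordinal h)) => i /=; rewrite subnKC //; lia.
  case: (leqP s (d - 2)) => sd.
    apply: (row0 r1) => r; rewrite rTh eqxx; apply: z1'; have := ltn_ord r; lia.
  apply: (row0 r2) => r; rewrite rTh eqxx (negbTE r12); apply: z2'.
  have := ltn_ord r; lia.
move/eqP; rewrite mulf_eq0 => /orP [/eqP //|/det0P [v vn0 hv]]; exfalso.
have vE (r : 'I_K) : \sum_i v 0 i * pairing (row i Th) r = 0.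
  have /rowP /(_ r) := hv; rewrite mxE [RHS]mxE => hr; rewrite -[RHS]hr.
  by apply: eq_bigr => i _; rewrite mxE.
have v1 : v 0 r1 = 0.
  have := vE r1; rewrite (bigD1 r1) //= big1 ?addr0.
    by rewrite rTh eqxx => /eqP; rewrite mulf_eq0 (negbTE ev1) orbF => /eqP.
  move=> i ir1; rewrite rTh (negbTE ir1); case: ifP => _.
    by rewrite z2 ?mulr0 // !inE eqxx orbT.
  by rewrite psi_ev 1?ltnW // -[_ == _]/(r1 == i) eq_sym (negbTE ir1) mulr0.
have v2 : v 0 r2 = 0.
  have := vE r2; rewrite (bigD1 r2) //= big1 ?addr0.
    by rewrite rTh eqxx (negbTE r12) => /eqP; rewrite mulf_eq0 (negbTE ev2) orbF => /eqP.
  move=> i ir2; have [->|ir1] := eqVneq i r1; first by rewrite v1 mul0r.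
  by rewrite rTh (negbTE ir1) (negbTE ir2) psi_ev 1?ltnW // -[_ == _]/(r2 == i) eq_sym (negbTE ir2) mulr0.
case/eqP: vn0; apply/rowP => i; rewrite mxE.
have [->//|ir1] := eqVneq i r1; have [->//|ir2] := eqVneq i r2.
have := vE i; rewrite (bigD1 i) //= big1 ?addr0.
  by rewrite rTh (negbTE ir1) (negbTE ir2) psi_ev 1?ltnW // eqxx mulr1.
move=> j ji; have [->|jr1] := eqVneq j r1; first by rewrite v1 mul0r.
have [->|jr2] := eqVneq j r2; first by rewrite v2 mul0r.
rewrite rTh (negbTE jr1) (negbTE jr2) psi_ev 1?ltnW // -[(i : nat) == j]/(i == j).
by rewrite eq_sym (negbTE ji) mulr0.
Qed.

(** A repetition in g makes the determinant vanish, so that the hypothesis on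
    injective g gives the relation for all rows, which extends
    multilinearly. *)
Lemma trace_moore_zero K (c : F) : (2 <= K)%N -> (K + 2 <= d)%N -> (m + 4 <= 2 * d)%N ->
  (forall g : {ffun 'I_K -> 'I_d}, injective g ->
     Tr (c * \sum_(I : {set 'I_K}) (\sum_(i in I) l (g i)) ^+ (2 ^ K - 1)) = 0) ->
  c = 0.
Proof.
move=> K2 Kd md hg; apply: (@moore_forms_free K) => // Th.
have hg' (g : {ffun 'I_K -> 'I_d}) :
    \sum_(s < m) c ^+ (2 ^ s) * \det (\matrix_(i, r < K) l (g i) ^+ (2 ^ (s + r))) = 0.
  have [/injectiveP gi|/injectivePn [i1 [i2 Di Ei]]] := boolP (injectiveb g); last first.
    by apply: big1 => s _; rewrite (determinant_alternate Di) ?mulr0 // => j; rewrite !mxE Ei.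
  rewrite -[RHS](hg g gi) (TrE hF) (sum_subsets_moore hF).
  apply: eq_bigr => s _; rewrite exprMn (frob_det hF); congr (_ * \det _).
  by apply/matrixP => i r; rewrite !mxE -exprM -expnD addnC.
transitivity (\sum_(g : {ffun 'I_K -> 'I_d}) (\prod_i Th i (g i)) *
   \sum_(s < m) c ^+ (2 ^ s) * \det (\matrix_(i, r < K) l (g i) ^+ (2 ^ (s + r)))); last first.
  by apply: big1 => g _; rewrite hg' mulr0.
under [RHS]eq_bigr do rewrite mulr_sumr.
rewrite exchange_big; apply: eq_bigr => s _ /=.
have -> : (\matrix_(i, r < K) pairing (row i Th) (s + r)) =
    Th *m (\matrix_(j < d, r < K) l j ^+ (2 ^ (s + r))).
  by apply/matrixP => i r; rewrite !mxE; apply: eq_bigr => j _; rewrite !mxE.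
rewrite (det_mul_rect hF) mulr_sumr; apply: eq_bigr => g _.
rewrite mulrCA; congr (_ * (_ * \det _)).
by apply/matrixP => i r; rewrite !mxE.
Qed.

End MooreForms.

(** * Replacing pq by a polynomial of half the degree *)

Section TracePolynomial.
Variables (F : finFieldType) (m : nat).
Hypothesis hF : #|F| = (2 ^ m)%N.
Variables (a b : nat -> F) (k : nat).

(** The value at x of a polynomial of Mathon's type, with coefficients indexed
    by all natural numbers so that the number n of terms can vary. *)
Definition mathon_sum (a : nat -> F) (n : nat) (x : F) : F := \sum_(i < n) a i * x ^+ (2 ^ i - 1).

Lemma mathon_sum_recl c n x : mathon_sum c n.+1 x = c 0%N + \sum_(i < n) c i.+1 * x ^+ (2 ^ i.+1 - 1).
Proof. by rewrite /mathon_sum big_ord_recl expr0 mulr1. Qed.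

(** In the product of the sums of the a_i x ^ (2 ^ i - 1) and of the
    b_j x ^ (2 ^ j - 1), the terms with i, j > 0 form a square; replacing it by its
    square root halves the degree and keeps the trace. *)
Definition trace_poly : {poly F} :=
  (a 0%N * b 0%N)%:P
  + \sum_(i < k.+1) (a 0%N * b i.+1 + b 0%N * a i.+1) *: 'X^(2 ^ i.+1 - 1)
  + \sum_(i < k.+1) \sum_(j < k.+1) sqrt2 m (a i.+1 * b j.+1) *: 'X^(2 ^ i + 2 ^ j - 1).

Lemma pow2_gt0 i : (0 < 2 ^ i)%N. Proof. by rewrite expn_gt0. Qed.

Lemma pow2_le i n : (i <= n)%N -> (2 ^ i <= 2 ^ n)%N.
Proof. by move=> h; rewrite leq_exp2l. Qed.

Lemma horner_trace_poly x : trace_poly.[x] = a 0%N * b 0%N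
  + \sum_(i < k.+1) (a 0%N * b i.+1 + b 0%N * a i.+1) * x ^+ (2 ^ i.+1 - 1)
  + \sum_(i < k.+1) \sum_(j < k.+1) sqrt2 m (a i.+1 * b j.+1) * x ^+ (2 ^ i + 2 ^ j - 1).
Proof.
rewrite /trace_poly !hornerD hornerC !horner_sum; congr (_ + _ + _).
  by apply: eq_bigr => i _; rewrite hornerZ hornerXn.
by apply: eq_bigr => i _; rewrite horner_sum; apply: eq_bigr => j _; rewrite hornerZ hornerXn.
Qed.

Lemma size_trace_poly : (size trace_poly <= 2 ^ k.+1)%N.
Proof.
have k0 := pow2_gt0 k.
rewrite (leq_trans (size_polyD _ _)) // geq_max; apply/andP; split.
  rewrite (leq_trans (size_polyD _ _)) // geq_max; apply/andP; split.
    by rewrite (leq_trans (size_polyC_leq1 _)) ?pow2_gt0.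
  apply: (leq_trans (size_sum _ _ _)); apply/bigmax_leqP => i _.
  rewrite (leq_trans (size_scale_leq _ _)) // size_polyXn.
  have := pow2_le (ltn_ord i); rewrite !expnS; have := pow2_gt0 i; lia.
apply: (leq_trans (size_sum _ _ _)); apply/bigmax_leqP => i _.
apply: (leq_trans (size_sum _ _ _)); apply/bigmax_leqP => j _.
rewrite (leq_trans (size_scale_leq _ _)) // size_polyXn expnS.
have := ltn_ord i; have := ltn_ord j; rewrite !ltnS => /pow2_le hj /pow2_le hi.
by have := pow2_gt0 i; lia.
Qed.

Lemma trace_poly_top : trace_poly`_(2 ^ k.+1 - 1) =
  a 0%N * b k.+1 + b 0%N * a k.+1 + sqrt2 m (a k.+1 * b k.+1).
Proof.
have k0 := pow2_gt0 k.
rewrite /trace_poly !coefD coefC !coef_sum ifN ?add0r; last by rewrite expnS; lia.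
congr (_ + _).
  rewrite (bigD1 ord_max) //= big1 ?addr0; last first.
    move=> i ik; rewrite coefZ coefXn; case: eqP => h; last by rewrite mulr0.
    case/eqP: ik; apply: val_inj => /=; apply/eqP.
    rewrite -(eqn_exp2l i k (m := 2)) //; move: h; rewrite !expnS.
    have := pow2_gt0 i; lia.
  by rewrite coefZ coefXn eqxx mulr1.
have hz (i j : 'I_k.+1) : (2 ^ k.+1 - 1 == 2 ^ i + 2 ^ j - 1)%N = (i == ord_max) && (j == ord_max).
  have := ltn_ord i; have := ltn_ord j; rewrite !ltnS => /pow2_le hj /pow2_le hi.
  rewrite -!(inj_eq val_inj) /= -(@eqn_exp2l 2 i) // -(@eqn_exp2l 2 j) //.
  rewrite expnS; have := pow2_gt0 i; lia.
rewrite (bigD1 ord_max) //= [X in _ + X]big1 ?addr0; last first.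
  move=> i ik; rewrite coef_sum big1 // => j _.
  by rewrite coefZ coefXn hz (negbTE ik) mulr0.
rewrite coef_sum (bigD1 ord_max) //= big1 ?addr0; last first.
  by move=> j jk; rewrite coefZ coefXn (hz ord_max) (negbTE jk) andbF mulr0.
by rewrite coefZ coefXn (hz ord_max ord_max) !eqxx mulr1.
Qed.

Lemma double_sum_sqr x :
  (\sum_(i < k.+1) \sum_(j < k.+1) sqrt2 m (a i.+1 * b j.+1) * x ^+ (2 ^ i + 2 ^ j - 1)) ^+ 2 =
  \sum_(i < k.+1) \sum_(j < k.+1) a i.+1 * b j.+1 * x ^+ (2 ^ i.+1 + 2 ^ j.+1 - 2).
Proof.
rewrite (frob_sum hF 1); apply: eq_bigr => i _; rewrite (frob_sum hF 1).
apply: eq_bigr => j _; rewrite exprMn (sqrt2K hF) -exprM; congr (_ * x ^+ _).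
rewrite !expnS; lia.
Qed.

Lemma Tr_trace_poly x : Tr trace_poly.[x] = Tr (mathon_sum a k.+2 x * mathon_sum b k.+2 x).
Proof.
rewrite horner_trace_poly !mathon_sum_recl.
set p := \sum_(i < k.+1) a i.+1 * _; set q := \sum_(i < k.+1) b i.+1 * _.
have -> : (a 0%N + p) * (b 0%N + q) = a 0%N * b 0%N + (a 0%N * q + b 0%N * p) + p * q by ring.
rewrite !(TrD hF); congr (_ + _ + _).
  rewrite -(TrD hF); congr (Tr _); rewrite !mulr_sumr -big_split; apply: eq_bigr => i _.
  by rewrite mulrDl !mulrA.
rewrite -(Tr_sqr hF) double_sum_sqr; congr (Tr _).
rewrite mulr_suml; apply: eq_bigr => i _; rewrite mulr_sumr; apply: eq_bigr => j _.
have -> : (2 ^ i.+1 + 2 ^ j.+1 - 2 = (2 ^ i.+1 - 1) + (2 ^ j.+1 - 1))%N.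
  have := pow2_gt0 i; have := pow2_gt0 j; rewrite !expnS; lia.
rewrite exprD; ring.
Qed.

(** Coefficient of x ^ (2 ^ (i + 1) + 2 ^ (j + 1) - 2) in the square of
    [trace_poly], as an unsymmetrized double sum. *)
Definition sqr_coef i j : F := a i.+1 * b j.+1 +
  (if i == j then (a 0%N * b i.+1 + b 0%N * a i.+1) ^+ 2 else 0).

Lemma trace_poly_sqr x : trace_poly.[x] ^+ 2 = (a 0%N * b 0%N) ^+ 2 +
  \sum_(i < k.+1) \sum_(j < k.+1) sqr_coef i j * x ^+ (2 ^ i.+1 + 2 ^ j.+1 - 2).
Proof.
rewrite horner_trace_poly !(sqrD hF) double_sum_sqr -addrA; congr (_ + _).
rewrite (frob_sum hF 1) -big_split; apply: eq_bigr => i _ /=.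
under [in RHS]eq_bigr do rewrite mulrDl.
rewrite big_split /= addrC; congr (_ + _).
rewrite [RHS](bigD1 i) //= big1 ?addr0; last first.
  by move=> j ji; rewrite eq_sym (inj_eq val_inj) (negbTE ji) mul0r.
rewrite eqxx exprMn -exprM; congr (_ * x ^+ _); have := pow2_gt0 i; rewrite !expnS; lia.
Qed.

End TracePolynomial.

(** * The leading coefficient, small index *)

Section Rigidity.
Variables (F : finFieldType) (m : nat).
Hypothesis hF : #|F| = (2 ^ m)%N.
Variables (d : nat) (A : {set F}) (a b : nat -> F).
Hypothesis hA : zmod_closed A.
Hypothesis cA : #|A| = (2 ^ d)%N.
Hypothesis hT : forall x, x \in A :\ 0 -> Tr (mathon_sum a d x * mathon_sum b d x) = 1.

Lemma sum1_even_card (T : finType) (B : {set T}) n : (0 < n)%N -> #|B| = (2 ^ n)%N ->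
  \sum_(x in B) (1 : F) = 0.
Proof.
move=> n0 cB; rewrite sumr_const cB -(prednK n0) expnS mulnC mulrnA.
by rewrite mulr2n (addrr_char2 hF).
Qed.

Lemma mathon_sum_at0 (c : nat -> F) n : mathon_sum c n.+1 0 = c 0%N.
Proof.
rewrite mathon_sum_recl big1 ?addr0 // => i _.
rewrite expr0n; case: eqP => h; last by rewrite mulr0.
by move: h; rewrite expnS; have := pow2_gt0 i; lia.
Qed.

(** The trace polynomial has too small a degree to have a nonzero sum over A,
    so its trace at 0 is the sum of the 2 ^ d - 1 values at the other points,
    which are all 1. *)
Lemma Tr_const_term : (2 <= d)%N -> Tr (a 0%N * b 0%N) = 1.
Proof.
move=> d2; set k := (d - 2)%N; have dk : d = k.+2 by rewrite /k; lia.
have : Tr (\sum_(x in A) (trace_poly m a b k).[x]) = 0.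
  rewrite (sum_subgroup hF) ?cA //; last first.
    by rewrite (leq_trans (size_trace_poly _ _ _ _)) // dk pow2_le.
  rewrite [_`__]nth_default ?mulr0 ?(Tr0 hF) //.
  rewrite (leq_trans (size_trace_poly _ _ _ _)) // dk !expnS; have := pow2_gt0 k; lia.
rewrite (Tr_sum hF) (bigD1 0) ?subgroup0 //= (Tr_trace_poly hF) !mathon_sum_at0 => h0.
have := sum1_even_card (ltnW d2) cA; rewrite (bigD1 0) ?subgroup0 //=.
have -> : \sum_(x in A | x != 0) (1 : F) = \sum_(x in A | x != 0) Tr (trace_poly m a b k).[x].
  apply: eq_bigr => x /andP [xA x0]; rewrite (Tr_trace_poly hF) -dk hT //.
  by rewrite !inE x0.
by move=> h1; move: h0; rewrite -[RHS]h1 => /addIr.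
Qed.

Lemma Tr_trace_poly_eq1 k : (k.+2 <= d)%N -> (forall i, (k.+2 <= i < d)%N -> a i = 0 /\ b i = 0) ->
  forall x, x \in A -> Tr (trace_poly m a b k).[x] = 1.
Proof.
move=> kd h0 x xA; rewrite (Tr_trace_poly hF).
have e c : (forall i, (k.+2 <= i < d)%N -> c i = 0) -> mathon_sum c k.+2 x = mathon_sum c d x.
  move=> hc; rewrite /mathon_sum -[in RHS](subnKC kd) big_split_ord /= [X in _ = _ + X]big1 ?addr0 // => i _.
  by rewrite hc ?mul0r //=; have := ltn_ord i; lia.
rewrite !e; try by move=> i /h0 [].
have [->|x0] := eqVneq x 0; last by apply: hT; rewrite !inE x0.
have -> : d = d.-1.+1 by lia.
by rewrite !mathon_sum_at0 Tr_const_term //; lia.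
Qed.

(** The hypothesis is that a_0 X ^ 2 + X Y + b_0 Y ^ 2, which is anisotropic,
    vanishes at (sqrt b_k, sqrt a_k). *)
Lemma top_coef_eq0 k : (2 <= d)%N ->
  a 0%N * b k + b 0%N * a k + sqrt2 m (a k * b k) = 0 -> a k = 0 /\ b k = 0.
Proof.
move=> d2 e; have := trace_one_anisotropic hF (x := sqrt2 m (b k)) (y := sqrt2 m (a k)) (Tr_const_term d2).
have -> : a 0%N * sqrt2 m (b k) ^+ 2 + sqrt2 m (b k) * sqrt2 m (a k)
   + b 0%N * sqrt2 m (a k) ^+ 2 = 0.
  rewrite !(sqrt2K hF) -[RHS]e /sqrt2 [RHS]addrAC exprMn; congr (_ + _ + _); ring.
case=> // hb ha.
by split; rewrite -[LHS](sqrt2K hF) ?ha ?hb expr0n.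
Qed.

(** The sum of Tr G over a subgroup of order 2 ^ (k + 1) of A, on which it is
    1, is the trace of the leading coefficient of G times the Moore determinant
    of a basis of the subgroup. *)
Lemma top_vanish_low k : (1 <= k)%N -> (k + 3 <= d)%N -> (m + 4 <= 2 * d)%N ->
  (forall i, (k.+2 <= i < d)%N -> a i = 0 /\ b i = 0) ->
  a k.+1 = 0 /\ b k.+1 = 0.
Proof.
move=> k1 kd md h0; apply: top_coef_eq0; first by lia.
rewrite -(trace_poly_top hF); set c := (trace_poly m a b k)`_(2 ^ k.+1 - 1).
have [l [il Al]] := subgroup_basis hF hA cA.
apply: (@trace_moore_zero F m d A l hF cA Al k.+1); try lia.
move=> g ig.
pose z (I : {set 'I_k.+1}) := \sum_(i in I) l (g i).
have zE I : z I = \sum_(i in g @: I) l i by rewrite /z big_imset //=; move=> x y _ _; apply: ig.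
have iz : injective z by move=> I J; rewrite !zE => /il /imset_inj -> //.
(* Z is the subgroup spanned by the l (g i) *)
pose Z := [set z I | I : {set 'I_k.+1}].
have cZ : #|Z| = (2 ^ k.+1)%N.
  by rewrite card_imset // -cardsT -powersetT card_powerset cardsT card_ord.
have zA I : z I \in A by rewrite zE Al; apply: imset_f.
have hZ : zmod_closed Z.
  apply: (subgroup_char2 hF) => [|_ _ /imsetP [I _ ->] /imsetP [J _ ->]].
    by apply/imsetP; exists set0 => //; rewrite /z big_set0.
  apply/imsetP; exists ((I :\: J) :|: (J :\: I)) => //.
  rewrite /z !(big_mkcond (fun i => i \in _)) -!big_split /=; apply: eq_bigr => i _.
  rewrite !inE; case: (i \in I); case: (i \in J) => /=;
    by rewrite ?addr0 ?add0r ?(addrr_char2 hF).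
have sumZ (f : F -> F) : \sum_(x in Z) f x = \sum_(I : {set 'I_k.+1}) f (z I).
  by rewrite big_imset //= => I J _ _; apply: iz.
have hM : \sum_(x in Z) x ^+ (2 ^ k.+1 - 1) = \prod_(x in Z :\ 0) x.
  transitivity (\sum_(x in Z) ('X^(2 ^ k.+1 - 1) : {poly F}).[x]).
    by apply: eq_bigr => x _; rewrite hornerXn.
  rewrite (sum_subgroup hF) ?cZ // ?size_polyXn; last by have := pow2_gt0 k.+1; lia.
  by rewrite coefXn subn1 eqxx mulr1.
rewrite -(sumZ (fun x => x ^+ (2 ^ k.+1 - 1))) hM mulrC /c subn1 -cZ.
rewrite -(sum_subgroup hF) ?cZ ?size_trace_poly // (Tr_sum hF).
rewrite (eq_bigr (fun _ => 1)) ?(sum1_even_card _ cZ) // => _ /imsetP [I _ ->].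
by apply: Tr_trace_poly_eq1 => //; lia.
Qed.

End Rigidity.

(** * The leading coefficient, largest index *)

Section TopCoefficient.
Variables (F : finFieldType) (m : nat).
Hypothesis hF : #|F| = (2 ^ m)%N.
Variables (k : nat) (A : {set F}) (a b : nat -> F).
Let d := k.+2.
Hypothesis hA : zmod_closed A.
Hypothesis cA : #|A| = (2 ^ d)%N.
Hypothesis hT : forall x, x \in A :\ 0 -> Tr (mathon_sum a d x * mathon_sum b d x) = 1.
Hypothesis md : (m + 5 <= 2 * d)%N.
Variable l : 'I_d -> F.
Hypothesis Al : A = [set \sum_(i in I) l i | I : {set 'I_d}].

Let dm : (d <= m)%N := d_le_m hF cA.
Let d_ge5 : (5 <= d)%N. Proof. by move: dm md; lia. Qed.

(** For e below 2 ^ d - 1 this is 0, and relations between Frobenius powers on A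
    reduce larger exponents. *)
Definition power_sum e : F := \sum_(x in A) x ^+ e.
Let M := \prod_(x in A :\ 0) x.

Lemma power_sum_low e : (e <= 2 ^ d - 1)%N -> power_sum e = if e == (2 ^ d - 1)%N then M else 0.
Proof.
move=> he; have d0 := pow2_gt0 d.
transitivity (\sum_(x in A) ('X^e : {poly F}).[x]).
  by apply: eq_bigr => x _; rewrite hornerXn.
rewrite (sum_subgroup hF) ?cA // ?size_polyXn; last by lia.
by rewrite coefXn subn1 eq_sym; case: eqP => _; rewrite ?mulr1 ?mulr0.
Qed.

Lemma power_sum_small e : (e < 2 ^ d - 1)%N -> power_sum e = 0.
Proof. by move=> he; rewrite power_sum_low ?(ltnW he) // ltn_eqF. Qed.

Lemma power_sum_reduce e : (forall r : 'I_d, power_sum (2 ^ r + e) = 0) -> power_sum (2 ^ d + e) = 0.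
Proof.
move=> h; have [v hv] := window_expand hF cA Al d.
transitivity (\sum_(r < d) v r * power_sum (2 ^ r + e)); last first.
  by apply: big1 => r _; rewrite h mulr0.
under [RHS]eq_bigr do rewrite mulr_sumr.
rewrite exchange_big; apply: eq_bigr => x xA /=.
rewrite exprD hv // mulr_suml; apply: eq_bigr => r _.
by rewrite exprD mulrA.
Qed.

Let Q := (2 ^ (d - 2))%N.

Lemma pow_class e : (e < d)%N ->
  [\/ e = (d - 1)%N /\ (2 ^ e = 2 * Q)%N, e = (d - 2)%N /\ (2 ^ e = Q)%N |
      (e <= d - 3)%N /\ (2 * 2 ^ e <= Q)%N].
Proof.
move=> ed; case: (ltngtP e (d - 2)%N) => h.
- apply: Or33; split; first by lia.
  by rewrite -expnS; apply: pow2_le.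
- apply: Or31; have -> : e = (d - 2).+1 by lia.
  by rewrite expnS; split=> //; lia.
- by apply: Or32; rewrite h.
Qed.

Lemma pow_top : (2 ^ d = 4 * Q)%N.
Proof. by rewrite /Q /d !subSS subn0 !expnS; lia. Qed.

Lemma Q_ge : (8 <= Q)%N.
Proof. by rewrite /Q -[8%N]/(2 ^ 3)%N; apply: pow2_le; move: d_ge5; lia. Qed.

Lemma pow_even e : (0 < e)%N -> exists h, (2 ^ e = 2 * h)%N.
Proof. by case: e => // e _; exists (2 ^ e)%N; rewrite expnS. Qed.

Lemma pow_le2Q e : (e < d)%N -> (2 ^ e <= 2 * Q)%N.
Proof. by move=> /pow_class []; lia. Qed.

(** As 6 Q is 2 ^ d + 2 ^ (d - 1), two reductions bring the exponent below
    2 ^ d - 1; in between, only the term with r = d - 1 is not yet small. *)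
Lemma power_sum_three w : (1 <= w <= d - 2)%N -> power_sum (6 * Q + 2 ^ w - 2) = 0.
Proof.
move=> hw; have Q8 := Q_ge.
have w2 : (2 <= 2 ^ w <= Q)%N.
  by rewrite /Q !leq_exp2l // -{1}(expn1 2) leq_exp2l //; case/andP: hw.
have -> : (6 * Q + 2 ^ w - 2 = 2 ^ d + (2 * Q + 2 ^ w - 2))%N by rewrite pow_top; lia.
apply: power_sum_reduce => r; case: (pow_class (ltn_ord r)) => -[_ hr]; last 2 first.
- by apply: power_sum_small; rewrite hr pow_top; lia.
- by apply: power_sum_small; rewrite pow_top; lia.
have -> : (2 ^ r + (2 * Q + 2 ^ w - 2) = 2 ^ d + (2 ^ w - 2))%N by rewrite hr pow_top; lia.
apply: power_sum_reduce => r'; apply: power_sum_small.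
by have := pow_le2Q (ltn_ord r'); rewrite pow_top; lia.
Qed.

Lemma power_sum_two o t : (o < d)%N -> (t < d)%N -> power_sum (2 ^ o + 2 ^ t) = 0.
Proof.
move=> od td; have Q8 := Q_ge.
have ho := pow_class od; have ht := pow_class td.
have [h|h] := ltnP (2 ^ o + 2 ^ t) (2 ^ d - 1); first exact: power_sum_small.
have -> : (2 ^ o + 2 ^ t = 2 ^ d + 0)%N.
  by rewrite pow_top in h *; case: ho => -[_ ho]; case: ht => -[_ ht]; lia.
apply: power_sum_reduce => r; apply: power_sum_small.
by have := pow_le2Q (ltn_ord r); rewrite pow_top; lia.
Qed.

(** The pairs of exponents for which [test_form] can be nonzero. *)
Definition exceptional o t :=
  [|| (o == d - 1) && (t == d - 1), (o == 0) && (d - 2 <= t) | (t == 0) && (d - 2 <= o)]%N.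

(** A sum of four powers of two below 2 ^ d reaches 2 ^ d + 1 in few ways. When
    the exponent is 2 ^ d - 1, parity forces o = 0 or t = 0 and the three other
    powers sum to 2 ^ d, so that the largest of them are 2 ^ (d - 1) and
    2 ^ (d - 2). When it is much larger, three of the powers are 2 ^ (d - 1). *)
Lemma power_sum_four i j o t : (0 < i < d)%N -> (0 < j < d)%N -> (o < d)%N -> (t < d)%N ->
  ~~ exceptional o t -> power_sum (2 ^ i + 2 ^ j - 2 + (2 ^ o + 2 ^ t)) = 0.
Proof.
move=> /andP [i0 id] /andP [j0 jd] od td; rewrite /exceptional !negb_or => /and3P [e1 e2 e3].
have Q8 := Q_ge; have [hi hi2] := pow_even i0; have [hj hj2] := pow_even j0.
have ci := pow_class id; have cj := pow_class jd; have co := pow_class od; have ct := pow_class td.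
have po := pow2_gt0 o; have pt := pow2_gt0 t.
have [lt|gt|eq] := ltngtP (2 ^ i + 2 ^ j - 2 + (2 ^ o + 2 ^ t)) (2 ^ d - 1).
- exact: power_sum_small.
- have [h|h] := ltnP (2 ^ i + 2 ^ j - 2 + (2 ^ o + 2 ^ t)) (6 * Q - 1).
    have -> : (2 ^ i + 2 ^ j - 2 + (2 ^ o + 2 ^ t) =
       2 ^ d + (2 ^ i + 2 ^ j - 2 + (2 ^ o + 2 ^ t) - 2 ^ d))%N.
      by move: gt; rewrite pow_top; lia.
    apply: power_sum_reduce => r; apply: power_sum_small.
    by have := pow_le2Q (ltn_ord r); move: gt h; rewrite pow_top; lia.
  have [[ei pi]|ci'] : (i = d - 1 /\ 2 ^ i = 2 * Q)%N \/ (2 ^ i <= Q)%N.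
  + by case: ci => -[? ?]; [left | right; lia | right; lia].
  + have [[ej pj]|cj'] : (j = d - 1 /\ 2 ^ j = 2 * Q)%N \/ (2 ^ j <= Q)%N.
    * by case: cj => -[? ?]; [left | right; lia | right; lia].
    * have [[eo po']|co'] : (o = d - 1 /\ 2 ^ o = 2 * Q)%N \/ (2 ^ o <= Q)%N.
      - by case: co => -[? ?]; [left | right; lia | right; lia].
      - have -> : (2 ^ i + 2 ^ j - 2 + (2 ^ o + 2 ^ t) = 6 * Q + 2 ^ t - 2)%N by lia.
        by apply: power_sum_three; move: e1 e2 e3; lia.
      - have [[et pt']|ct'] : (t = d - 1 /\ 2 ^ t = 2 * Q)%N \/ (2 ^ t <= Q)%N.
        + by case: ct => -[? ?]; [left | right; lia | right; lia].
        + have -> : (2 ^ i + 2 ^ j - 2 + (2 ^ o + 2 ^ t) = 6 * Q + 2 ^ o - 2)%N by lia.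
          apply: power_sum_three; case: co => -[eo co]; move: e1 e2 e3; lia.
        + by exfalso; lia.
    * exfalso; case: co => -[eo co]; case: ct => -[et ct]; move: e1 e2 e3; lia.
  + exfalso; case: cj => -[ej cj]; case: co => -[eo co]; case: ct => -[et ct]; move: e1 e2 e3; lia.
- exfalso; move: eq; rewrite pow_top => eq.
  have [o0|o0] := posnP o; have [t0|t0] := posnP t.
  + by move: eq; rewrite o0 t0 expn0; lia.
  + case: ct e2 => -[et ct]; rewrite o0 /=; try lia; move=> _.
    move: eq; rewrite o0 expn0.
    by case: ci => -[_ ci]; case: cj => -[_ cj]; lia.
  + case: co e3 => -[eo co]; rewrite t0 /=; try lia; move=> _.
    move: eq; rewrite t0 expn0.
    by case: ci => -[_ ci]; case: cj => -[_ cj]; lia.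
  + have [ho ho2] := pow_even o0; have [ht ht2] := pow_even t0; lia.
Qed.

(** The bilinear form u, v |-> sum over A of G ^ 2 u v on Frobenius powers, where
    G is the trace polynomial. On the first d powers it has only the entries at
    the exceptional pairs. *)
Definition test_form o t : F :=
  \sum_(x in A) (trace_poly m a b k).[x] ^+ 2 * x ^+ (2 ^ o + 2 ^ t).

Lemma test_formE o t : test_form o t = (a 0%N * b 0%N) ^+ 2 * power_sum (2 ^ o + 2 ^ t) +
  \sum_(i < k.+1) \sum_(j < k.+1) sqr_coef a b i j *
     power_sum (2 ^ i.+1 + 2 ^ j.+1 - 2 + (2 ^ o + 2 ^ t)).
Proof.
rewrite /test_form; under eq_bigr do rewrite (trace_poly_sqr hF) mulrDl.
rewrite big_split /= -mulr_sumr; congr (_ + _).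
under eq_bigr do rewrite mulr_suml.
rewrite exchange_big; apply: eq_bigr => i _ /=.
under eq_bigr do rewrite mulr_suml.
rewrite exchange_big; apply: eq_bigr => j _ /=.
rewrite mulr_sumr; apply: eq_bigr => x _.
by rewrite -mulrA -exprD.
Qed.

Lemma test_form_zero o t : (o < d)%N -> (t < d)%N -> ~~ exceptional o t -> test_form o t = 0.
Proof.
move=> od td h; rewrite test_formE power_sum_two // mulr0 add0r big1 // => i _.
rewrite big1 // => j _; rewrite power_sum_four ?mulr0 //=.
  exact: (ltn_ord i).
exact: (ltn_ord j).
Qed.

Lemma test_form_top : test_form (d - 1) (d - 1) = sqr_coef a b k k * M ^+ 2.
Proof.
have Q8 := Q_ge; have e1 : (2 ^ (d - 1) + 2 ^ (d - 1) = 2 ^ d)%N.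
  by rewrite /d subn1 /= !expnS; lia.
rewrite test_formE power_sum_two ?mulr0 ?add0r //; try by rewrite /d; lia.
rewrite e1.
have z (i j : 'I_k.+1) : ~~ ((i == ord_max) && (j == ord_max)) ->
    power_sum (2 ^ i.+1 + 2 ^ j.+1 - 2 + 2 ^ d) = 0.
  have id : (i.+1 < d)%N by exact: (ltn_ord i).
  have jd : (j.+1 < d)%N by exact: (ltn_ord j).
  rewrite -!(inj_eq val_inj) /= => nij.
  have pi := pow2_gt0 i.+1; have pj := pow2_gt0 j.+1.
  have [h|h] := ltnP (2 ^ i.+1 + 2 ^ j.+1 - 2) (2 * Q - 1).
    rewrite addnC; apply: power_sum_reduce => r; apply: power_sum_small.
    by have := pow_le2Q (ltn_ord r); rewrite pow_top; lia.
  case: (pow_class id) => -[ei ci].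
  - have -> : (2 ^ i.+1 + 2 ^ j.+1 - 2 + 2 ^ d = 6 * Q + 2 ^ j.+1 - 2)%N by rewrite ci pow_top; lia.
    by apply: power_sum_three; move: nij ei jd; rewrite /d; lia.
  - have -> : (2 ^ i.+1 + 2 ^ j.+1 - 2 + 2 ^ d = 6 * Q + 2 ^ i.+1 - 2)%N.
      rewrite pow_top; case: (pow_class jd) => -[_ cj]; lia.
    by apply: power_sum_three; move: nij ei jd; rewrite /d; lia.
  - have -> : (2 ^ i.+1 + 2 ^ j.+1 - 2 + 2 ^ d = 6 * Q + 2 ^ i.+1 - 2)%N.
      rewrite pow_top; case: (pow_class jd) => -[_ cj]; lia.
    by apply: power_sum_three; move: nij ei jd; rewrite /d; lia.
rewrite (bigD1 ord_max) //= [X in _ + X]big1 ?addr0; last first.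
  by move=> i ik; rewrite big1 // => j _; rewrite z ?mulr0 // (negbTE ik).
rewrite (bigD1 ord_max) //= [X in _ + X]big1 ?addr0; last first.
  by move=> j jk; rewrite (z ord_max) ?mulr0 // (negbTE jk) andbF.
congr (_ * _).
have -> : (2 ^ k.+1 + 2 ^ k.+1 - 2 + 2 ^ d = (2 ^ d - 1) * 2)%N.
  by rewrite /d !expnS; have := pow2_gt0 k; lia.
have <- : power_sum (2 ^ d - 1) = M by rewrite power_sum_low // eqxx.
rewrite /power_sum (frob_sum hF 1); apply: eq_bigr => x _; by rewrite exprM.
Qed.

Lemma test_formC o t : test_form o t = test_form t o.
Proof. by apply: eq_bigr => x _; rewrite addnC. Qed.

Lemma test_form_period o t : test_form o (t + m) = test_form o t.
Proof. by apply: eq_bigr => x _; rewrite !exprD (frob_period hF). Qed.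

Lemma test_form_expand (t : nat) (v : 'I_d -> F) o :
  (forall x, x \in A -> x ^+ (2 ^ t) = \sum_(r < d) v r * x ^+ (2 ^ r)) ->
  test_form o t = \sum_(r < d) v r * test_form o r.
Proof.
move=> hv; rewrite /test_form; under [RHS]eq_bigr do rewrite mulr_sumr.
rewrite exchange_big; apply: eq_bigr => x xA /=.
rewrite exprD hv // !mulr_sumr; apply: eq_bigr => r _; rewrite exprD; ring.
Qed.

(** By bilinearity the first d columns determine the others. *)
Lemma test_form_row0 o : (forall t, (t < d)%N -> test_form o t = 0) -> forall t, test_form o t = 0.
Proof.
move=> h t; have [v hv] := window_expand hF cA Al t.
by rewrite (test_form_expand _ hv) big1 // => r _; rewrite h ?mulr0.
Qed.

(** Since Tr G = 1 on A, the sum over A of Tr G x * x ^ (1 + 2 ^ tau) is a power sum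
    of small degree. Expanding the trace gives conjugates of values of
    [test_form]. *)
Lemma trace_test tau : \sum_(s < m) test_form (m - s) (tau + (m - s)) ^+ (2 ^ s) = 0.
Proof.
have z : power_sum (1 + 2 ^ tau) = 0.
  have [v hv] := window_expand hF cA Al tau.
  transitivity (\sum_(r < d) v r * power_sum (2 ^ 0 + 2 ^ r)); last first.
    by apply: big1 => r _; rewrite power_sum_two ?mulr0 // /d.
  under [RHS]eq_bigr do rewrite mulr_sumr.
  rewrite exchange_big; apply: eq_bigr => x xA /=.
  rewrite exprD hv // !mulr_sumr; apply: eq_bigr => r _; rewrite exprD; ring.
rewrite -[RHS]z /power_sum.
transitivity (\sum_(x in A) \sum_(s < m) ((trace_poly m a b k).[x] ^+ 2) ^+ (2 ^ s) * x ^+ (1 + 2 ^ tau)).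
  rewrite exchange_big; apply: eq_bigr => s _; rewrite (frob_sum hF).
  apply: eq_bigr => x _; rewrite exprMn; congr (_ * _).
  rewrite -exprM mulnDl -!expnD subnK ?(ltnW (ltn_ord s)) // -addnA subnK ?(ltnW (ltn_ord s)) //.
  by rewrite !exprD frob_period // -{1}[m]add0n (frob_period hF) expn0.
apply: eq_bigr => x xA; rewrite -mulr_suml -[RHS]mul1r; congr (_ * _).
rewrite -(TrE hF) (Tr_sqr hF).
by apply: (Tr_trace_poly_eq1 hF hA cA hT) => //; rewrite -/d => i; lia.
Qed.

Lemma trace_test_single tau o : (1 <= o <= m)%N ->
  (forall o', (1 <= o' <= m)%N -> o' != o -> test_form o' (o' + tau) = 0) ->
  test_form o (o + tau) = 0.
Proof.
move=> ho h; have := trace_test tau.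
have so : (m - o < m)%N by lia.
rewrite (bigD1 (Ordinal so)) //= big1 ?addr0.
  rewrite subKn; last by lia.
  by rewrite addnC => /eqP; rewrite expf_eq0 => /andP [_ /eqP].
move=> s hs; rewrite addnC h ?expr0n ?expn_eq0 //; have sm := ltn_ord s; first by lia.
apply: contraNneq hs => e; apply/eqP/val_inj => /=; lia.
Qed.

Lemma test_form_mid o t : (1 <= o <= d - 3)%N -> test_form o t = 0.
Proof.
move=> ho; apply: test_form_row0 => r rd; apply: test_form_zero => //; first by lia.
by rewrite /exceptional; lia.
Qed.

Lemma test_form_mid_mod o t : (m < t <= m + d - 3)%N -> test_form o t = 0.
Proof.
by move=> ht; rewrite -(subnK (ltnW (proj1 (andP ht)))) test_form_period test_formC test_form_mid //; lia.
Qed.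

(** With tau = m - d + 2, m - d + 1 and m - d, the only values
    [test_form o (o + tau)] that are not yet known to vanish are those at (d - 2, m),
    (d - 1, m) and (d - 1, m - 1): in all other cases o or o + tau lies modulo m
    between 1 and d - 3, or in a row already shown to be 0. The first two say that
    the entries (d - 2, 0) and (d - 1, 0) are 0. Then the third is the entry
    (d - 1, d - 1) times the coefficient at d - 1 of x ^ (2 ^ (m - 1)), which is
    nonzero because -1, 0, ..., d - 2 is a window. *)
Lemma sqr_coef_top : sqr_coef a b k k = 0.
Proof.
have g0 : test_form (d - 2) 0 = 0.
  rewrite -[LHS]test_form_period.
  have -> : (0 + m = d - 2 + (m - d + 2))%N by move: dm; rewrite /d; lia.
  apply: trace_test_single => [|o ho od]; first by move: dm; rewrite /d; lia.
  have [h|h] := leqP o (d - 3); first by apply: test_form_mid; lia.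
  by apply: test_form_mid_mod; move: dm md d_ge5 ho od h; lia.
have row2 t : test_form (d - 2) t = 0.
  apply: test_form_row0 => -[//|r] rd; apply: test_form_zero => //; first by rewrite /d; lia.
  by rewrite /exceptional /d; lia.
have D0 : test_form (d - 1) 0 = 0.
  rewrite -[LHS]test_form_period.
  have -> : (0 + m = d - 1 + (m - d + 1))%N by move: dm; rewrite /d; lia.
  apply: trace_test_single => [|o ho od]; first by move: dm; rewrite /d; lia.
  have [h|h] := leqP o (d - 3); first by apply: test_form_mid; lia.
  have [->|h2] := eqVneq o (d - 2)%N; first exact: row2.
  by apply: test_form_mid_mod; move: dm md d_ge5 ho od h h2; lia.
have row0 t : test_form 0 t = 0.
  apply: test_form_row0 => r rd.
  have [->|r1] := eqVneq r (d - 1)%N; first by rewrite test_formC.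
  have [->|r2] := eqVneq r (d - 2)%N; first by rewrite test_formC.
  by apply: test_form_zero => //; rewrite /exceptional /d; move: rd r1 r2 d_ge5; rewrite /d; lia.
have fl : test_form (d - 1) (m - 1) = 0.
  have -> : (m - 1 = d - 1 + (m - d))%N by move: dm; rewrite /d; lia.
  apply: trace_test_single => [|o ho od]; first by move: dm; rewrite /d; lia.
  have [h|h] := leqP o (d - 3); first by apply: test_form_mid; lia.
  have [->|h2] := eqVneq o (d - 2)%N; first exact: row2.
  have [->|h3] := eqVneq o d.
    by rewrite (subnKC dm) -[X in test_form _ X]add0n test_form_period test_formC row0.
  have [->|h4] := eqVneq o m.
    by rewrite addnC test_form_period test_formC -[X in test_form _ X]add0n test_form_period test_formC row0.
  by apply: test_form_mid_mod; move: dm md d_ge5 ho od h h2 h3 h4; lia.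
have [v hv] := window_expand hF cA Al (m - 1).
have dd : (d - 1 < d)%N by rewrite /d; lia.
move: fl; rewrite (test_form_expand _ hv) (bigD1 (Ordinal dd)) //= big1 ?addr0; last first.
  move=> r hr; have [->|r0] := eqVneq (r : nat) 0%N; first by rewrite D0 mulr0.
  rewrite test_form_zero ?mulr0 // /exceptional.
  have : (r != d - 1 :> nat)%N by apply: contraNneq hr => e; apply/eqP/val_inj.
  by move: r0 d_ge5; rewrite /d; lia.
move/eqP; rewrite test_form_top mulrA mulf_eq0 sqrf_eq0 (negbTE (prod_nonzero A)) orbF mulf_eq0.
case/orP => /eqP // v0; exfalso.
(* if v vanishes at d - 1, then the powers -1, 0, ..., d - 2 are dependent on A *)
pose c (r : 'I_d) : F := if (r : nat) is r'.+1 then v (inord r') else 1.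
have c0 r : c r = 0.
  apply: (@window_free F m d A hF cA c (m - 1)%N _ r) => x xA.
  rewrite /c big_ord_recl /= addn0 hv // mul1r big_ord_recr /=.
  have -> : v ord_max = 0 by rewrite -v0; congr v; apply: val_inj; rewrite /= /d; lia.
  rewrite mul0r addr0 -big_split big1 //= => i _.
  rewrite /bump /= add1n.
  have -> : (m - 1 + i.+1 = i + m)%N by move: dm; rewrite /d; lia.
  rewrite (frob_period hF).
  have -> : v (inord i) = v (widen_ord (leqnSn _) i).
    by congr v; apply: val_inj; rewrite /= inordK //; apply: ltn_trans (ltn_ord i) _.
  exact: addrr_char2 hF _.
by have /eqP := c0 ord0; rewrite /c /= oner_eq0.
Qed.

End TopCoefficient.

(** * Rigidity of {p,q}-maps of large degree *)

Section RigidityTheorem.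
Variables (F : finFieldType) (m : nat).
Hypothesis hF : #|F| = (2 ^ m)%N.

(** Descending induction on the index, the last nonzero coefficients being in one
    of the two ranges treated above. *)
Theorem rigidity (d : nat) (A : {set F}) (a b : nat -> F) :
  zmod_closed A -> #|A| = (2 ^ d)%N -> (m + 5 <= 2 * d)%N ->
  (forall x, x \in A :\ 0 -> Tr (mathon_sum a d x * mathon_sum b d x) = 1) ->
  forall i, (2 <= i < d)%N -> a i = 0 /\ b i = 0.
Proof.
move=> hA cA md hT.
have d2 : (2 <= d)%N.
  by have := m_gt0 hF; lia.
suff h n : forall i, (2 <= i)%N -> (d - n <= i < d)%N -> a i = 0 /\ b i = 0.
  by move=> i /andP [i2 id]; apply: (h d) => //; lia.
elim: n => [|n IH] i i2 hi; first by lia.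
have [h|h] := leqP (d - n) i; first by apply: IH => //; lia.
case: i i2 hi h => [//|k] k1 hi h.
have top0 j : (k.+2 <= j < d)%N -> a j = 0 /\ b j = 0.
  by move=> hj; apply: IH; lia.
have [kd|kd] := leqP (k + 3) d.
  by apply: (top_vanish_low hF hA cA hT) => //; lia.
have dk : d = k.+2 by lia.
apply: (top_coef_eq0 hF hA cA hT d2).
move: cA md hT; rewrite dk => cA' md' hT'.
have [l [il Al]] := subgroup_basis hF hA cA'.
have := sqr_coef_top hF hA cA' hT' md' Al; rewrite /sqr_coef eqxx => e.
apply/eqP; rewrite -sqrf_eq0; apply/eqP; rewrite -[RHS]e (sqrD hF) (sqrt2K hF).
by rewrite addrC.
Qed.
End RigidityTheorem.

(** * Points and conics of the plane *)

Section Points.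
Variable F : finFieldType.

Lemma vecE (x y z : F) : (vec x y z 0 0 = x) * (vec x y z 0 1 = y) * (vec x y z 0 2%:R = z).
Proof. by rewrite /vec !mxE. Qed.

Lemma vec_eta (v : 'rV[F]_3) : v = vec (v 0 0) (v 0 1) (v 0 2%:R).
Proof.
apply/rowP => i; rewrite mxE; case: i => -[|[|[|//]]] hi /=; congr (v 0 _); exact: val_inj.
Qed.

Lemma vecZ (c x y z : F) : c *: vec x y z = vec (c * x) (c * y) (c * z).
Proof. by apply/rowP => -[[|[|[|//]]] hi]; rewrite !mxE. Qed.

Lemma vec_eq0 (x y z : F) : (vec x y z == 0) = [&& x == 0, y == 0 & z == 0].
Proof.
apply/eqP/and3P => [e|[/eqP -> /eqP -> /eqP ->]].
  have := vecE x y z; rewrite e !mxE => -[[-> ->] ->]; by rewrite !eqxx.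
by apply/rowP => -[[|[|[|//]]] hi]; rewrite !mxE.
Qed.

Lemma point_sub n (x y z : F) (L : 'M[F]_(n, 3)) : (point x y z <= L)%MS = (vec x y z <= L)%MS.
Proof. by rewrite /point genmxE. Qed.

(** Homogeneous coordinates are unique up to a scalar. *)
Lemma gen_row_eq (v w : 'rV[F]_3) : v != 0 -> <<v>>%MS = <<w>>%MS ->
  exists2 c, c != 0 & v = c *: w.
Proof.
move=> v0 /genmxP /eqmxP e; have : (v <= w)%MS by rewrite e.
move=> /sub_rVP [c hc]; exists c => //.
by apply: contraNneq v0 => c0; rewrite hc c0 scale0r.
Qed.

Lemma gen_rowZ c (v : 'rV[F]_3) : c != 0 -> <<c *: v>>%MS = <<v>>%MS.
Proof. by move=> c0; apply/genmxP/eqmxP; apply: eqmx_scale. Qed.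

Lemma point_eq (x y z x' y' z' : F) : ~~ [&& x == 0, y == 0 & z == 0] ->
  point x y z = point x' y' z' ->
  exists2 c, c != 0 & [/\ x = c * x', y = c * y' & z = c * z'].
Proof.
rewrite -vec_eq0 => h /(gen_row_eq h) [c c0]; rewrite vecZ => e; exists c => //.
have := vecE x y z; rewrite e !vecE => -[[? ?] ?]; split=> //.
Qed.

Lemma pointZ (c x y z : F) : c != 0 -> point (c * x) (c * y) (c * z) = point x y z.
Proof. by move=> c0; rewrite /point -vecZ gen_rowZ. Qed.

Lemma point_PG2 (x y z : F) : ~~ [&& x == 0, y == 0 & z == 0] -> point x y z \in PG2 F.
Proof.
rewrite -vec_eq0 => h; rewrite inE /point genmx_id eqxx /= mxrank_gen rank_rV h //.
Qed.

Lemma in_conic (alpha beta lambda x y z : F) : ~~ [&& x == 0, y == 0 & z == 0] ->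
  (point x y z \in conic alpha beta lambda) =
  (alpha * x ^+ 2 + x * y + beta * y ^+ 2 + lambda * z ^+ 2 == 0).
Proof.
move=> h; apply/imsetP/eqP => [[[[x' y'] z']]|e].
  rewrite inE /= => /andP [_ /eqP e] pe.
  have [c _ [-> -> ->]] := point_eq h pe.
  by rewrite -[RHS](mulr0 (c ^+ 2)) -e; ring.
exists (x, y, z) => //=; rewrite inE /= e eqxx andbT.
by apply: contraNneq h => -[-> -> ->]; rewrite !eqxx.
Qed.

End Points.

(** * Arcs of {p,q}-maps are maximal *)

Section Mathon.
Variables (F : finFieldType) (m : nat).
Hypothesis hF : #|F| = (2 ^ m)%N.
Variables (p q : {poly F}) (A : {set F}) (d : nat).
Hypothesis hA : zmod_closed A.
Hypothesis cA : #|A| = (2 ^ d)%N.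
Hypothesis hT : forall x, x \in A :\ 0 -> Tr (p.[x] * q.[x]) = 1.
Hypothesis pD : forall x y, (x + y) * p.[x + y] = x * p.[x] + y * p.[y].
Hypothesis qD : forall x y, (x + y) * q.[x + y] = x * q.[x] + y * q.[y].

Let mathon_comp (f : F -> F) x y := (x * f x + y * f y) / (x + y).
(** Mathon's composition [mathon_comp] with the two weights exchanged. A common
    point of the conics of x and y is a zero of the form whose outer coefficients
    are the cross compositions of p and of q. *)
Let cross_comp (f : F -> F) x y := (y * f x + x * f y) / (x + y).

Lemma comp_cross_identity (f g : F -> F) x y : x + y != 0 ->
  f x * g x + f y * g y + mathon_comp f x y * mathon_comp g x y = cross_comp f x y * cross_comp g x y.
Proof.
move=> xy; apply/eqP; rewrite -(addr_eq0_char2 hF); apply/eqP.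
rewrite /mathon_comp /cross_comp.
(* in characteristic two the difference of the two sides is X + X *)
pose X := ((x ^+ 2 + x * y + y ^+ 2) * (f x * g x + f y * g y)
           + x * y * (f x * g y + f y * g x)) / (x + y) ^+ 2.
transitivity (X + X); last exact: addrr_char2 hF _.
by rewrite /X; field.
Qed.

Lemma poly_comp (f : {poly F}) x y :
  (forall x y, (x + y) * f.[x + y] = x * f.[x] + y * f.[y]) -> x + y != 0 ->
  f.[x + y] = mathon_comp (horner f) x y.
Proof. by move=> fD xy; rewrite /mathon_comp -fD mulrC mulKf. Qed.

Lemma subgroup_nonzeroD x y : x \in A :\ 0 -> y \in A :\ 0 -> x != y -> x + y \in A :\ 0.
Proof.
rewrite !inE => /andP [_ hx] /andP [_ hy] xy.
by rewrite (addr_eq0_char2 hF) xy (subgroupD hF).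
Qed.

Lemma Tr_cross_comp x y : x \in A :\ 0 -> y \in A :\ 0 -> x != y ->
  Tr (cross_comp (horner p) x y * cross_comp (horner q) x y) = 1.
Proof.
move=> hx hy xy; have xy0 : x + y != 0 by rewrite (addr_eq0_char2 hF).
rewrite -comp_cross_identity // -!poly_comp // !(TrD hF) !hT //; last exact: subgroup_nonzeroD.
by rewrite (addrr_char2 hF) add0r.
Qed.

(** A line z = u x + v y meets the conic of t only if h t = 0. The
    shift t w ^ 2 disappears in the cross composition, so the identity for the
    shifted maps has the same right-hand side as for p and q. It says that h + 1
    is additive. *)
Lemma Tr_line u v x y : x \in A :\ 0 -> y \in A :\ 0 -> x != y ->
  let h t := Tr ((p.[t] + t * u ^+ 2) * (q.[t] + t * v ^+ 2)) in
  h x + h y + h (x + y) = 1.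
Proof.
move=> hx hy xy h; have xy0 : x + y != 0 by rewrite (addr_eq0_char2 hF).
pose hat (f : {poly F}) w t := f.[t] + t * w ^+ 2.
have hcomp (f : {poly F}) w :
    (forall x y, (x + y) * f.[x + y] = x * f.[x] + y * f.[y]) ->
    hat f w (x + y) = mathon_comp (hat f w) x y.
  move=> fD; rewrite /hat poly_comp // /mathon_comp.
  have e : (x + y) ^+ 2 = x ^+ 2 + y ^+ 2 by apply: sqrD hF _ _.
  have -> : x * (f.[x] + x * w ^+ 2) + y * (f.[y] + y * w ^+ 2) =
     x * f.[x] + y * f.[y] + (x + y) ^+ 2 * w ^+ 2 by rewrite e; ring.
  by field.
have hanti (f : {poly F}) w : cross_comp (hat f w) x y = cross_comp (horner f) x y.
  rewrite /cross_comp /hat.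
  have -> : y * (f.[x] + x * w ^+ 2) + x * (f.[y] + y * w ^+ 2) =
     y * f.[x] + x * f.[y] + (x * y * w ^+ 2 + x * y * w ^+ 2) by ring.
  by rewrite (addrr_char2 hF) addr0.
rewrite -(Tr_cross_comp hx hy xy) -(hanti p u) -(hanti q v) -comp_cross_identity //.
by rewrite -!hcomp // !(TrD hF).
Qed.

(** A direction from the nucleus: Some t is (t : 1) and None is (1 : 0). *)
Let dx (o : option F) : F := if o is Some t then t else 1.
Let dy (o : option F) : F := if o is Some t then 1 else 0.
Let zz x (o : option F) : F :=
  sqrt2 m ((p.[x] * dx o ^+ 2 + dx o * dy o + q.[x] * dy o ^+ 2) / x).
Let pt x o : 'M[F]_3 := point (dx o) (dy o) (zz x o).

Lemma dir_neq0 o (z : F) : ~~ [&& dx o == 0, dy o == 0 & z == 0].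
Proof. by case: o => [t|] /=; rewrite oner_eq0 ?andbF. Qed.

Lemma dir_exists (x y : F) : ~~ [&& x == 0 & y == 0] ->
  exists2 c, c != 0 & exists o, x = c * dx o /\ y = c * dy o.
Proof.
have [->|y0] := eqVneq y 0.
  by rewrite andbT => x0; exists x => //; exists None; rewrite /= mulr1 mulr0.
by move=> _; exists y => //; exists (Some (x / y)); rewrite /= mulr1 mulrC divfK.
Qed.

Lemma dir_inj c o o' : dx o = c * dx o' -> dy o = c * dy o' -> o = o' /\ c = 1.
Proof.
case: o => [t|]; case: o' => [t'|] /=; rewrite ?mulr1 ?mulr0.
- by move=> e ec; rewrite e -ec mul1r.
- by move=> _ /eqP; rewrite oner_eq0.
- by move=> e c0; move: e; rewrite -c0 mul0r => /eqP; rewrite oner_eq0.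
- by move=> <-.
Qed.

Lemma dir_cross o o' : dx o * dy o' + dy o * dx o' = 0 -> o = o'.
Proof.
case: o => [t|]; case: o' => [t'|] /=; rewrite ?mulr1 ?mulr0 ?mul1r ?mul0r ?addr0 ?add0r //.
- by move=> /eqP; rewrite (addr_eq0_char2 hF) => /eqP ->.
- by move=> /eqP; rewrite oner_eq0.
- by move=> /eqP; rewrite oner_eq0.
Qed.

Lemma zz_sqr x o : x != 0 ->
  x * zz x o ^+ 2 = p.[x] * dx o ^+ 2 + dx o * dy o + q.[x] * dy o ^+ 2.
Proof. by move=> x0; rewrite (sqrt2K hF) mulrC divfK. Qed.

(** The conics are disjoint: a common point of two of them is a zero of a form
    whose trace is 1. *)
Lemma pt_inj x o x' o' : x \in A :\ 0 -> x' \in A :\ 0 ->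
  pt x o = pt x' o' -> x = x' /\ o = o'.
Proof.
move=> hx hx' /(point_eq (dir_neq0 _ _)) [c c0 [e1 e2]].
have [eo c1] := dir_inj e1 e2; rewrite c1 mul1r -eo => e3; split=> //.
apply/eqP; apply/negPn/negP => xx'.
have x0 : x != 0 by move: hx; rewrite !inE => /andP [].
have x0' : x' != 0 by move: hx'; rewrite !inE => /andP [].
have xy0 : x + x' != 0 by rewrite (addr_eq0_char2 hF).
have := zz_sqr o x0; have := zz_sqr o x0'; rewrite -e3; set z := zz x o => h' h.
have := trace_one_anisotropic hF (x := dx o) (y := dy o) (Tr_cross_comp hx hx' xx').
have -> : cross_comp (horner p) x x' * dx o ^+ 2 + dx o * dy o + cross_comp (horner q) x x' * dy o ^+ 2 = 0.
  transitivity ((x' * (p.[x] * dx o ^+ 2 + dx o * dy o + q.[x] * dy o ^+ 2)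
     + x * (p.[x'] * dx o ^+ 2 + dx o * dy o + q.[x'] * dy o ^+ 2)) / (x + x')).
    by rewrite /cross_comp; field.
  rewrite -h -h'.
  have -> : x' * (x * z ^+ 2) + x * (x' * z ^+ 2) = x * x' * z ^+ 2 + x * x' * z ^+ 2 by ring.
  by rewrite (addrr_char2 hF) mul0r.
by case=> // a0 b0; have := dir_neq0 o 0; rewrite a0 b0 !eqxx.
Qed.

Let R : {set F * option F} := setX (A :\ 0) setT.

(** Each conic has exactly one point in every direction from the nucleus. *)
Lemma pq_arcE : pq_arc p q A = point 0 0 1 |: [set pt u.1 u.2 | u in R].
Proof.
congr (_ |: _); apply/setP => P; apply/bigcupP/imsetP => [[x hx]|[[x o]]].
  move=> /imsetP [[[x1 y1] z1]]; rewrite inE /= => /andP [h /eqP e] ->.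
  have x0 : x != 0 by move: hx; rewrite !inE => /andP [].
  have xy0 : ~~ [&& x1 == 0 & y1 == 0].
    apply/negP => /andP [/eqP x10 /eqP y10]; move: h e.
    rewrite x10 y10 !expr0n /= !mulr0 !add0r => h /eqP.
    rewrite mulf_eq0 (negbTE x0) sqrf_eq0 /= => /eqP z0.
    by move: h; rewrite z0 eqxx.
  have [c c0 [o [ex ey]]] := dir_exists xy0.
  exists (x, o); first by rewrite !inE andbT -in_setD1.
  rewrite /pt /= -[RHS](pointZ _ _ _ c0) -ex -ey; congr point.
  apply: (frob_inj hF (i := 1)); rewrite /= expn1 exprMn.
  apply: (mulfI x0); rewrite [RHS]mulrCA zz_sqr //.
  apply/eqP; rewrite -(addr_eq0_char2 hF) -[X in _ == X]e ex ey; apply/eqP.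
  ring.
rewrite inE /= => /andP [hx _] ->; exists x => //.
have x0 : x != 0 by move: hx; rewrite !inE => /andP [].
by rewrite in_conic ?dir_neq0 // zz_sqr // (addrr_char2 hF).
Qed.

Lemma card_dirs : #|[set: option F]| = (2 ^ m + 1)%N.
Proof. by rewrite cardsT card_option hF addn1. Qed.

Lemma card_subgroup_nonzero : #|A :\ 0| = (2 ^ d - 1)%N.
Proof. by rewrite -cA (cardsD1 0 A) subgroup0 // add1n subn1. Qed.

Lemma dir_nucleus (x : F) o : pt x o != point 0 0 1.
Proof.
apply/eqP => /(point_eq (dir_neq0 _ _)) [c _ [e1 e2 _]].
by have := dir_neq0 o 0; rewrite e1 e2 !mulr0 !eqxx.
Qed.

Lemma card_pq_arc : #|pq_arc p q A| = (#|F| * (2 ^ d - 1) + 2 ^ d)%N.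
Proof.
rewrite pq_arcE cardsU1 card_in_imset; last first.
  move=> [x o] [x' o']; rewrite !in_setX !inE /= !andbT => hx hx' /pt_inj [].
  - by rewrite !inE.
  - by rewrite !inE.
  - by move=> -> ->.
have -> : point 0 0 1 \notin [set pt u.1 u.2 | u in R].
  by apply/imsetP => -[u _ /esym/eqP]; apply/negP/dir_nucleus.
rewrite cardsX card_dirs card_subgroup_nonzero hF; have := pow2_gt0 d; nia.
Qed.

Lemma pq_arc_PG2 : pq_arc p q A \subset PG2 F.
Proof.
rewrite pq_arcE; apply/subsetP => P; rewrite in_setU1 => /orP [/eqP ->|/imsetP [[x o] _ ->]].
  by apply: point_PG2; rewrite oner_eq0 !andbF.
exact: point_PG2 (dir_neq0 _ _).
Qed.

Lemma quad_dirs (alpha beta : F) :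
  (#|[set o : option F | (alpha * dx o ^+ 2 + dx o * dy o + beta * dy o ^+ 2 == 0)%R]| <= 2)%N.
Proof.
set D := [set o | _].
suff [o1 [o2 h]] : exists o1 o2, D \subset [set o1; o2].
  by apply: leq_trans (subset_leq_card h) _; rewrite cards2; case: eqP.
have [a0|a0] := eqVneq alpha 0.
  (* alpha = 0: the form is y (x + beta y) *)
  exists None, (Some beta); apply/subsetP => -[t|]; rewrite !inE ?orbT //= a0.
  by rewrite mul0r add0r expr1n !mulr1 (addr_eq0_char2 hF) => /eqP ->; rewrite eqxx.
have [/existsP [t0 /eqP h0]|/existsPn h] := boolP [exists t : F, alpha * t ^+ 2 + t + beta == 0].
  (* the roots of a quadratic polynomial sum to 1 / alpha *)
  exists (Some t0), (Some (t0 + alpha^-1)); apply/subsetP => -[t|]; rewrite !inE /=; last first.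
    by rewrite expr1n !expr0n /= !mulr0 !addr0 mulr1 (negbTE a0).
  rewrite expr1n !mulr1 => /eqP ht.
  have : (t + t0) * (t + t0 + alpha^-1) == 0.
    have -> : (t + t0) * (t + t0 + alpha^-1) = (alpha * t ^+ 2 + t + beta) / alpha +
      (alpha * t0 ^+ 2 + t0 + beta) / alpha + ((t * t0 - beta / alpha) + (t * t0 - beta / alpha)) by field.
    by rewrite ht h0 mul0r !add0r (addrr_char2 hF).
  rewrite mulf_eq0 -addrA !(addr_eq0_char2 hF) => /orP [/eqP ->|/eqP ->]; by rewrite ?eqxx ?orbT.
exists None, None; apply/subsetP => -[t|]; rewrite !inE //= expr1n !mulr1 => /eqP ht.
by have := h t; rewrite ht eqxx.
Qed.

Let line (u v w : F) := [set P in pq_arc p q A | P *m (vec u v w)^T == 0].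

Lemma on_line (u v w x y z : F) :
  (point x y z *m (vec u v w)^T == 0) = (x * u + y * v + z * w == 0).
Proof.
rewrite -[_ == 0]/(_) -!sub_kermx point_sub sub_kermx.
apply/eqP/eqP => [/matrixP /(_ 0 0)|e].
  by rewrite !mxE !big_ord_recl big_ord0 !mxE /= addr0 addrA.
apply/matrixP => i j; rewrite !ord1 !mxE !big_ord_recl big_ord0 !mxE /= addr0 addrA.
exact: e.
Qed.

(** Such a line passes through the nucleus and meets every conic once. *)
Lemma line_nucleus u v : ~~ [&& u == 0 & v == 0] -> (#|line u v 0%R| <= 2 ^ d)%N.
Proof.
move=> uv; have vu : ~~ [&& v == 0 & u == 0] by rewrite andbC.
have [c c0 [o0 [eqv eu]]] := dir_exists vu.
suff h : line u v 0 \subset point 0 0 1 |: [set pt x o0 | x in A :\ 0].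
  apply: leq_trans (subset_leq_card h) _; rewrite cardsU1.
  apply: (leq_trans (leq_add (leq_b1 _) (leq_imset_card _ _))).
  by rewrite card_subgroup_nonzero; have := pow2_gt0 d; lia.
apply/subsetP => P; rewrite inE pq_arcE in_setU1 => /andP [/orP [/eqP -> _|]]; first exact: setU11.
move=> /imsetP [[x o]]; rewrite in_setX /= => /andP [hx _] -> .
rewrite on_line mulr0 addr0 => /eqP e; apply/setU1P; right.
apply/imsetP; exists x => //; suff eo : o = o0 by rewrite /= eo.
have : dx o * dy o0 + dy o * dx o0 = 0.
  by apply: (mulfI c0); rewrite mulr0 -[RHS]e eu eqv; ring.
exact: dir_cross.
Qed.

(** Adding a fixed element of G maps G into its complement in A, by [Tr_line],
    so at most half of A indexes conics that meet the line, each in at most two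
    points. *)
Lemma line_affine u v : (#|line u v 1%R| <= 2 ^ d)%N.
Proof.
pose h t := Tr ((p.[t] + t * u ^+ 2) * (q.[t] + t * v ^+ 2)).
pose G := [set x in A :\ 0 | h x == 0].
pose D x := [set o : option F | (p.[x] + x * u ^+ 2) * dx o ^+ 2 + dx o * dy o
    + (q.[x] + x * v ^+ 2) * dy o ^+ 2 == 0].
have inG y : (y \in G) = (y \in A :\ 0) && (h y == 0) by rewrite [LHS]in_set.
have hG : (2 * #|G| <= 2 ^ d)%N.
  have [->|[x xG]] := set_0Vmem G; first by rewrite cards0.
  rewrite -cA mul2n -addnn -{2}(card_imset G (addrI x)).
  rewrite -cardsUI [G :&: _](_ : _ = set0) ?cards0 ?addn0.
    apply: subset_leq_card; apply/subsetP => y; rewrite in_setU => /orP [].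
      by rewrite !inE => /andP [/andP []].
    move=> /imsetP [z]; move: xG; rewrite !inE => /andP [/andP [_ xA] _] /andP [/andP [_ zA] _] ->.
    exact: (subgroupD hF hA).
  apply/setP => y; rewrite in_set0; apply/negP; rewrite in_setI => /andP [yG /imsetP [z zG ey]].
  move: yG zG xG; rewrite ey !inG => /andP [n0 /eqP h0] /andP [zA /eqP hz] /andP [xA /eqP hx].
  have xz : x != z by move: n0; rewrite !inE (addr_eq0_char2 hF) => /andP [].
  have : h x + h z + h (x + z) = 1 := Tr_line u v xA zA xz.
  by rewrite h0 hz hx !addr0 => /eqP; rewrite eq_sym oner_eq0.
suff sub : line u v 1 \subset \bigcup_(x in G) [set pt x o | o in D x].
  apply: leq_trans (subset_leq_card sub) _; apply: leq_trans hG.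
  rewrite mulnC -sum_nat_const.
  apply: (@leq_trans (\sum_(x in G) #|[set pt x o | o in D x]|)).
    elim/big_rec2: _ => [|x n B _ IH]; first by rewrite cards0.
    by apply: leq_trans (leq_card_setU _ _) _; rewrite leq_add2l.
  apply: leq_sum => x _; apply: leq_trans (leq_imset_card _ _) _.
  exact: quad_dirs.
apply/subsetP => P; rewrite inE pq_arcE in_setU1 => /andP [/orP [/eqP ->|]].
  by rewrite on_line !mul0r !add0r mul1r oner_eq0.
move=> /imsetP [[x o]]; rewrite in_setX /= => /andP [hx _] -> .
rewrite on_line mulr1 (addr_eq0_char2 hF) => /eqP e.
have x0 : x != 0 by move: hx; rewrite !inE => /andP [].
have oD : (p.[x] + x * u ^+ 2) * dx o ^+ 2 + dx o * dy o
    + (q.[x] + x * v ^+ 2) * dy o ^+ 2 = 0.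
  have := zz_sqr o x0; rewrite -e (sqrD hF) => e2.
  have -> : (p.[x] + x * u ^+ 2) * dx o ^+ 2 + dx o * dy o + (q.[x] + x * v ^+ 2) * dy o ^+ 2
    = (p.[x] * dx o ^+ 2 + dx o * dy o + q.[x] * dy o ^+ 2)
      + x * ((dx o * u) ^+ 2 + (dy o * v) ^+ 2) by ring.
  by rewrite -e2 (addrr_char2 hF).
apply/bigcupP; exists x; last by apply: imset_f; rewrite inE oD.
rewrite inG hx /=; case: (Tr01 hF ((p.[x] + x * u ^+ 2) * (q.[x] + x * v ^+ 2))) => hh.
  by rewrite /h hh.
have [a0 b0] := trace_one_anisotropic hF hh oD.
by have := dir_neq0 o 0; rewrite a0 b0 !eqxx.
Qed.

Lemma line_section u v w : ~~ [&& u == 0, v == 0 & w == 0] -> (#|line u v w| <= 2 ^ d)%N.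
Proof.
have [->|w0] := eqVneq w 0; first by rewrite !andbT; apply: line_nucleus.
move=> _; suff -> : line u v w = line (u / w) (v / w) 1 by apply: line_affine.
apply/setP => P; rewrite !in_set; congr (_ && _).
have -> : vec u v w = w *: vec (u / w) (v / w) 1.
  by rewrite vecZ mulr1 ![w * (_ / _)]mulrC !divfK.
by rewrite linearZ /= -scalemxAr scaler_eq0 (negbTE w0).
Qed.

Theorem pq_arc_maximal : maximal_arc (2 ^ d) (pq_arc p q A).
Proof.
split; [exact: pq_arc_PG2 | exact: card_pq_arc |].
move=> S SK cS [L rL SL].
have [w w0 hw] : exists2 w : 'rV[F]_3, w != 0 & L *m w^T = 0.
  have : kermx L^T != 0 by rewrite kermx_eq0 /row_free mxrank_tr rL.
  move=> /rowV0Pn [w /sub_kermxP hw w0]; exists w => //.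
  by apply: trmx_inj; rewrite trmx_mul trmxK hw trmx0.
have Sline : S \subset line (w 0 0) (w 0 1) (w 0 2%:R).
  apply/subsetP => P PS; rewrite inE (subsetP SK) //= -vec_eta.
  have /submxP [D ->] := SL P PS.
  by rewrite -mulmxA hw mulmx0.
have nw : ~~ [&& w 0 0 == 0, w 0 1 == 0 & w 0 2%:R == 0] by rewrite -vec_eq0 -vec_eta.
have := leq_trans (subset_leq_card Sline) (line_section nw).
by rewrite cS ltnn.
Qed.

End Mathon.

(** * Affine maps give Denniston arcs *)

Section AffineDenniston.
Variables (F : finFieldType) (m : nat).
Hypothesis hF : #|F| = (2 ^ m)%N.

(** The collineation that sends z to z + s x + t y. *)
Definition shear (s t : F) : 'M[F]_3 :=
  \matrix_(i < 3, j < 3) if j == 2%:R then [:: s; t; 1]`_i else (i == j)%:R.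

Lemma vec_shear s t (x y z : F) : vec x y z *m shear s t = vec x y (x * s + y * t + z).
Proof.
apply/rowP => -[[|[|[|//]]] hi]; rewrite !mxE !big_ord_recl big_ord0 !mxE /=;
  by rewrite ?mulr1 ?mulr0 ?addr0 ?add0r // addrA.
Qed.

Lemma shear_unit s t : shear s t \in unitmx.
Proof.
rewrite unitmxE unitfE; apply/det0P => -[v v0]; rewrite (vec_eta v) vec_shear => /eqP.
rewrite vec_eq0 => /and3P [/eqP x0 /eqP y0]; rewrite x0 y0 !mul0r !add0r => /eqP z0.
by case/negP: v0; rewrite (vec_eta v) vec_eq0 x0 y0 z0 !eqxx.
Qed.

Lemma gen_mulmx (v : 'rV[F]_3) (M : 'M[F]_3) : <<<<v>> *m M>>%MS = <<v *m M>>%MS.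
Proof. by apply/eq_genmx/eqmxMr/genmxE. Qed.

(** With s ^ 2 = a_1 and t ^ 2 = b_1 the conic of x reads
    a_0 X ^ 2 + X Y + b_0 Y ^ 2 = x (Z + s X + t Y) ^ 2. *)
Lemma affine_denniston (p q : {poly F}) (A : {set F}) (a0 a1 b0 b1 : F) :
  zmod_closed A -> Tr (a0 * b0) = 1 ->
  (forall x, x \in A :\ 0 -> p.[x] = a0 + a1 * x) ->
  (forall x, x \in A :\ 0 -> q.[x] = b0 + b1 * x) ->
  denniston (pq_arc p q A).
Proof.
move=> hA hT hp hq; exists a0, 1, b0, A; split=> //.
  by split; rewrite ?oner_eq0 // expr1n divr1.
set s := sqrt2 m a1; set t := sqrt2 m b1.
have key (x y z : F) : (x * s + y * t + z) ^+ 2 = a1 * x ^+ 2 + b1 * y ^+ 2 + z ^+ 2.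
  by rewrite !(sqrD hF) !exprMn !(sqrt2K hF) mulrC [y ^+ 2 * _]mulrC.
exists (shear s t); first exact: shear_unit.
apply/setP => P; apply/setU1P/imsetP => [[->|/bigcupP [x xA]]|[Q /imsetP [[x y] hxy ->] ->]].
- exists (point 0 0 1).
    apply/imsetP; exists (0, 0) => //.
    by rewrite inE /= expr0n /= !mulr0 !addr0 subgroup0.
  by rewrite gen_mulmx vec_shear !mul0r !add0r.
- move=> /imsetP [[[x1 y1] z1]]; rewrite inE /= => /andP [h /eqP e] ->.
  set w := x1 * s + y1 * t + z1.
  have x0 : x != 0 by move: xA; rewrite !inE => /andP [].
  have e2 : a0 * x1 ^+ 2 + x1 * y1 + b0 * y1 ^+ 2 = x * w ^+ 2.
    apply/eqP; rewrite -(addr_eq0_char2 hF) -[X in _ == X]e key hp // hq //; apply/eqP; ring.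
  have w0 : w != 0.
    apply: contraNneq h => w0; move: e2; rewrite w0 expr0n mulr0 => /(trace_one_anisotropic hF hT) [xx yy].
    by move: w0; rewrite /w xx yy !mul0r !add0r => ->; rewrite eqxx.
  exists (point (x1 / w) (y1 / w) 1).
    apply/imsetP; exists (x1 / w, y1 / w) => //; rewrite inE /=.
    have -> : a0 * (x1 / w) ^+ 2 + 1 * (x1 / w) * (y1 / w) + b0 * (y1 / w) ^+ 2 =
       (a0 * x1 ^+ 2 + x1 * y1 + b0 * y1 ^+ 2) / w ^+ 2 by field.
    rewrite e2 mulfK ?expf_neq0 //; by move: xA; rewrite !inE => /andP [].
  rewrite gen_mulmx vec_shear -[RHS]/(point _ _ _) -[RHS](pointZ _ _ _ w0).
  congr point; try by rewrite mulrC divfK.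
  have -> : w * (x1 / w * s + y1 / w * t + 1) = x1 * s + y1 * t + w by field.
  by rewrite /w addrA (addrr_char2 hF) add0r.
- move: hxy; rewrite inE /= mul1r; set x' := a0 * _ + _ + _ => xA.
  rewrite gen_mulmx vec_shear; have [x0|x0] := eqVneq x' 0.
    have [-> ->] := trace_one_anisotropic hF hT x0; left.
    by rewrite !mul0r !add0r.
  have xA' : x' \in A :\ 0 by rewrite !inE x0.
  right; apply/bigcupP; exists x' => //.
  rewrite -/(point x y (x * s + y * t + 1)) in_conic; last first.
    apply/negP => /and3P [/eqP -> /eqP ->]; by rewrite !mul0r !add0r oner_eq0.
  rewrite key hp // hq //; apply/eqP.
  transitivity ((a0 * x ^+ 2 + x * y + b0 * y ^+ 2) + x' + x' * (a1 * x ^+ 2 + b1 * y ^+ 2)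
      + x' * (a1 * x ^+ 2 + b1 * y ^+ 2)); first by ring.
  by rewrite -/x' (addrr_char2 hF) add0r (addrr_char2 hF).
Qed.

End AffineDenniston.

(** * Denniston arcs come from affine maps *)

Section NonDenniston.
Variables (F : finFieldType) (m : nat).
Hypothesis hF : #|F| = (2 ^ m)%N.
Variables (p q : {poly F}) (A : {set F}) (d : nat).
Hypothesis hA : zmod_closed A.
Hypothesis cA : #|A| = (2 ^ d)%N.
Hypothesis hT : forall x, x \in A :\ 0 -> Tr (p.[x] * q.[x]) = 1.
Hypothesis pD : forall x y, (x + y) * p.[x + y] = x * p.[x] + y * p.[y].
Hypothesis qD : forall x y, (x + y) * q.[x + y] = x * q.[x] + y * q.[y].
Hypothesis d2 : (2 <= d)%N.
Hypothesis dm : (4 * 2 ^ d < 2 ^ m)%N.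

Variables (a h b : F) (A' : {set F}) (M : 'M[F]_3).
Hypothesis abh : irreducible_form a h b.
Hypothesis hM : M \in unitmx.
Hypothesis hK : pq_arc p q A = [set <<P *m M>>%MS | P in denniston_set a h b A'].

Let N := invmx M.
Let l1 x y z := x * N 0 0 + y * N 1 0 + z * N 2%:R 0.
Let l2 x y z := x * N 0 1 + y * N 1 1 + z * N 2%:R 1.
Let l3 x y z := x * N 0 2%:R + y * N 1 2%:R + z * N 2%:R 2%:R.

Lemma vecN (x y z : F) : vec x y z *m N = vec (l1 x y z) (l2 x y z) (l3 x y z).
Proof.
apply/rowP => j; rewrite [LHS]mxE !big_ord_recl big_ord0 !mxE addr0 /=.
case: j => -[|[|[|//]]] hj; rewrite /= addrA /l1 /l2 /l3;
  congr (_ * N _ _ + _ * N _ _ + _ * N _ _); exact: val_inj.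
Qed.

Lemma form_a_neq0 : a != 0.
Proof.
have [_ hT'] := abh; apply/eqP => a0; move: hT'; rewrite a0 !mul0r (Tr0 hF) => /eqP.
by rewrite eq_sym oner_eq0.
Qed.

Lemma form_b_neq0 : b != 0.
Proof.
have [_ hT'] := abh; apply/eqP => a0; move: hT'; rewrite a0 mulr0 mul0r (Tr0 hF) => /eqP.
by rewrite eq_sym oner_eq0.
Qed.

Let pencil_form x y z mu := a * l1 x y z ^+ 2 + h * l1 x y z * l2 x y z + b * l2 x y z ^+ 2
   + mu * l3 x y z ^+ 2.

(** The inverse collineation sends the point to one of a Denniston set, and the
    scalar between the coordinate vectors disappears by homogeneity. *)
Lemma on_pencil x x1 y1 z1 : x \in A :\ 0 -> ~~ [&& x1 == 0, y1 == 0 & z1 == 0] ->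
  p.[x] * x1 ^+ 2 + x1 * y1 + q.[x] * y1 ^+ 2 + x * z1 ^+ 2 = 0 ->
  exists2 mu, mu \in A' & pencil_form x1 y1 z1 mu = 0.
Proof.
move=> xA n0 e.
have : point x1 y1 z1 \in pq_arc p q A.
  apply/setU1P; right; apply/bigcupP; exists x => //; rewrite in_conic //; exact/eqP.
rewrite hK => /imsetP [P /imsetP [[x' y'] hxy ->]] /=; rewrite gen_mulmx.
have n0' : vec x1 y1 z1 != 0 by rewrite vec_eq0.
move=> /(gen_row_eq n0') [c c0 eqv].
have : vec x1 y1 z1 *m N = c *: vec x' y' 1 by rewrite eqv -scalemxAl mulmxK.
rewrite vecN vecZ => ee.
have := vecE (l1 x1 y1 z1) (l2 x1 y1 z1) (l3 x1 y1 z1); rewrite ee !vecE => -[[h1 h2] h3].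
move: hxy; rewrite inE /= => hxy.
exists (a * x' ^+ 2 + h * x' * y' + b * y' ^+ 2) => //.
rewrite /pencil_form -h1 -h2 -h3 mulr1.
set X := a * x' ^+ 2 + _ + _.
transitivity (c ^+ 2 * X + c ^+ 2 * X); last exact: addrr_char2 hF _.
rewrite /X; ring.
Qed.

(** The Denniston set has one point on the line x = 0 for each element of A', and
    a line contains at most 2 ^ d points of the arc. *)
Lemma card_denniston_subgroup : (#|A'| <= 2 ^ d)%N.
Proof.
(* w is the image of the line x = 0 *)
pose w : 'rV[F]_3 := (N *m (delta_mx 0 0 : 'cV_3))^T.
have w0 : w != 0.
  rewrite -(inj_eq trmx_inj) trmx0 trmxK; apply/eqP => e.
  have : M *m (N *m (delta_mx 0 0 : 'cV[F]_3)) = 0 by rewrite e mulmx0.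
  rewrite mulKVmx // => /matrixP /(_ 0 0); rewrite !mxE eqxx => /eqP.
  by rewrite oner_eq0.
have nw : ~~ [&& w 0 0 == 0, w 0 1 == 0 & w 0 2%:R == 0] by rewrite -vec_eq0 -vec_eta.
have := line_section hF hA cA hT pD qD nw; rewrite -vec_eta; apply: leq_trans.
pose f mu : 'M[F]_3 := <<vec 0 (sqrt2 m (mu / b)) 1 *m M>>%MS.
rewrite -(card_in_imset (f := f) (D := A')).
  apply: subset_leq_card; apply/subsetP => _ /imsetP [mu hmu ->]; rewrite inE; apply/andP; split.
    rewrite hK; apply/imsetP; exists (point 0 (sqrt2 m (mu / b)) 1); last by rewrite gen_mulmx.
    apply/imsetP; exists (0, sqrt2 m (mu / b)) => //; rewrite inE /=.
    rewrite expr0n /= !mulr0 mul0r !add0r (sqrt2K hF) mulrC divfK //; exact: form_b_neq0.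
  rewrite /f trmxK -sub_kermx genmxE sub_kermx mulmxA -(mulmxA _ M) mulmxV // mulmx1.
  apply/eqP/matrixP => i j; rewrite !ord1 !mxE !big_ord_recl big_ord0 !mxE /=.
  by rewrite mul0r !mulr0 !addr0.
move=> mu mu' _ _; rewrite /f => /gen_row_eq [|c c0].
  rewrite -[X in _ != X](mul0mx _ M) (inj_eq (can_inj (mulmxK hM))) vec_eq0 oner_eq0 !andbF //.
rewrite scalemxAl => /(can_inj (mulmxK hM)); rewrite vecZ => e.
have := vecE 0 (sqrt2 m (mu / b)) 1; rewrite e !vecE => -[[_ e1] e2].
move: e1; have -> : c = 1 by rewrite -[LHS]mulr1.
rewrite mul1r => /(congr1 (fun x => x ^+ 2)); rewrite !(sqrt2K hF) => /(mulIf _) -> //.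
by rewrite invr_eq0 form_b_neq0.
Qed.

Let Cxx mu := a * N 0 0 ^+ 2 + h * N 0 0 * N 0 1 + b * N 0 1 ^+ 2 + mu * N 0 2%:R ^+ 2.
Let Cyy mu := a * N 1 0 ^+ 2 + h * N 1 0 * N 1 1 + b * N 1 1 ^+ 2 + mu * N 1 2%:R ^+ 2.
Let Czz mu := a * N 2%:R 0 ^+ 2 + h * N 2%:R 0 * N 2%:R 1 + b * N 2%:R 1 ^+ 2 + mu * N 2%:R 2%:R ^+ 2.
Let Cxy := h * (N 0 0 * N 1 1 + N 1 0 * N 0 1).
Let Cxz := h * (N 0 0 * N 2%:R 1 + N 2%:R 0 * N 0 1).
Let Cyz := h * (N 1 0 * N 2%:R 1 + N 2%:R 0 * N 1 1).

Lemma pencil_formE x y z mu : pencil_form x y z mu =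
  Cxx mu * x ^+ 2 + Cyy mu * y ^+ 2 + Czz mu * z ^+ 2 + Cxy * (x * y) + Cxz * (x * z) + Cyz * (y * z).
Proof.
rewrite /pencil_form /Cxx /Cyy /Czz /Cxy /Cxz /Cyz /l1 /l2 /l3 !(sqrD hF); ring.
Qed.

(** With P ^ 2 = p(x), Q ^ 2 = q(x) and i ^ 2 = 1 / x, the points
    (s ^ 2 : 1 : (P s ^ 2 + s + Q) i) lie on the conic of x. Each of them is a
    zero of some form of the pencil, that is, s is a root of one of the
    polynomials R mu of degree at most 4. There are at most 2 ^ d of these and more
    than 4 * 2 ^ d values of s, so one R mu is 0, and its coefficients make the
    form proportional to the equation of the conic. *)
Lemma conic_in_pencil x : x \in A :\ 0 -> exists mu,
  [/\ Cxz = 0, Cyz = 0, Czz mu = x * Cxy, Cxx mu = p.[x] * Cxy & Cyy mu = q.[x] * Cxy].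
Proof.
move=> xA; have x0 : x != 0 by move: xA; rewrite !inE => /andP [].
set P := sqrt2 m p.[x]; set Q := sqrt2 m q.[x]; set i := (sqrt2 m x)^-1.
have i2 : i ^+ 2 = x^-1 by rewrite exprVn (sqrt2K hF).
have i0 : i != 0 by rewrite -sqrf_eq0 i2 invr_eq0.
have P2 : P ^+ 2 = p.[x] by rewrite (sqrt2K hF).
have Q2 : Q ^+ 2 = q.[x] by rewrite (sqrt2K hF).
pose R mu : {poly F} := Poly [:: Cyy mu + Czz mu * Q ^+ 2 * i ^+ 2 + Cyz * Q * i; Cyz * i;
   Czz mu * i ^+ 2 + Cxy + Cxz * Q * i + Cyz * P * i; Cxz * i;
   Cxx mu + Czz mu * P ^+ 2 * i ^+ 2 + Cxz * P * i].
have key s : ((P * s ^+ 2 + s + Q) * i) ^+ 2 = (P ^+ 2 * (s ^+ 2) ^+ 2 + s ^+ 2 + Q ^+ 2) * i ^+ 2.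
  by rewrite exprMn !(sqrD hF) exprMn.
have horner_R mu s : (R mu).[s] = pencil_form (s ^+ 2) 1 ((P * s ^+ 2 + s + Q) * i) mu.
  rewrite pencil_formE key horner_Poly /=; ring.
have hroot s : exists2 mu, mu \in A' & root (R mu) s.
  have n0 : ~~ [&& s ^+ 2 == 0, (1 : F) == 0 & (P * s ^+ 2 + s + Q) * i == 0].
    by rewrite oner_eq0 andbF.
  have [|mu hmu e] := on_pencil xA n0.
    rewrite key i2 P2 Q2.
    transitivity ((p.[x] * (s ^+ 2) ^+ 2 + s ^+ 2 + q.[x]) +
      (p.[x] * (s ^+ 2) ^+ 2 + s ^+ 2 + q.[x])); last exact: addrr_char2 hF _.
    by field.
  by exists mu => //; rewrite /root horner_R e.
have [mu muA' Rmu] : exists2 mu, mu \in A' & R mu = 0.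
  suff /exists_inP [mu hmu /eqP e] : [exists mu in A', R mu == 0] by exists mu.
  apply: contraLR (dm) => /exists_inPn hn; rewrite -leqNgt -hF.
  have : [set: F] \subset \bigcup_(mu in A') [set s | root (R mu) s].
    apply/subsetP => s _; have [mu hmu hs] := hroot s.
    by apply/bigcupP; exists mu => //; rewrite inE.
  move=> /subset_leq_card; rewrite cardsT => /leq_trans; apply.
  apply: (@leq_trans (\sum_(mu in A') #|[set s | root (R mu) s]|)).
    elim/big_rec2: _ => [|mu n B _ IH]; first by rewrite cards0.
    by apply: leq_trans (leq_card_setU _ _) _; rewrite leq_add2l.
  apply: (@leq_trans (\sum_(mu in A') 4)).
    apply: leq_sum => mu hmu; have Rn0 := hn mu hmu.
    have hall : all (root (R mu)) (enum [set s | root (R mu) s]).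
      by apply/allP => s; rewrite mem_enum inE.
    have := max_poly_roots Rn0 hall (enum_uniq _); rewrite -cardE => h1.
    have := size_Poly [:: Cyy mu + Czz mu * Q ^+ 2 * i ^+ 2 + Cyz * Q * i; Cyz * i;
      Czz mu * i ^+ 2 + Cxy + Cxz * Q * i + Cyz * P * i; Cxz * i;
      Cxx mu + Czz mu * P ^+ 2 * i ^+ 2 + Cxz * P * i].
    by move=> h2; have := leq_trans h1 h2.
  by rewrite sum_nat_const mulnC leq_mul2l card_denniston_subgroup.
have coefR k : (R mu)`_k = 0 by rewrite Rmu coef0.
have := coefR 0%N; have := coefR 1%N; have := coefR 2%N; have := coefR 3%N; have := coefR 4%N.
rewrite !coef_Poly /= => c4 c3 c2 c1 c0'.
have xz0 : Cxz = 0 by move/eqP: c3; rewrite mulf_eq0 (negbTE i0) orbF => /eqP.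
have yz0 : Cyz = 0 by move/eqP: c1; rewrite mulf_eq0 (negbTE i0) orbF => /eqP.
have zz : Czz mu = x * Cxy.
  move: c2; rewrite xz0 yz0 !mul0r !addr0 i2 => /eqP; rewrite (addr_eq0_char2 hF) => /eqP <-.
  by rewrite mulrC divfK.
exists mu; split=> //.
  move: c4; rewrite xz0 !mul0r !addr0 i2 P2 zz => /eqP; rewrite (addr_eq0_char2 hF) => /eqP ->.
  by field.
move: c0'; rewrite yz0 !mul0r !addr0 i2 Q2 zz => /eqP; rewrite (addr_eq0_char2 hF) => /eqP ->.
by field.
Qed.

Lemma A0_two : exists x y, [/\ x \in A :\ 0, y \in A :\ 0 & x != y].
Proof.
have c : (1 < #|A :\ 0%R|)%N.
  by rewrite (card_subgroup_nonzero (d := d)) //; have := pow2_le d2; lia.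
by have /card_gt1P [x [y [? ? ?]]] := c; exists x, y.
Qed.

(** Otherwise a whole form of the pencil would be 0, but at the preimage of
    (1 : 0 : 0) it takes the value a. *)
Lemma Cxy_neq0 : Cxy != 0.
Proof.
apply/eqP => e; have [x [_ [xA _ _]]] := A0_two.
have [mu [e1 e2]] := conic_in_pencil xA; rewrite e !mulr0 => e3 e4 e5.
have f0 x1 y1 z1 : pencil_form x1 y1 z1 mu = 0.
  by rewrite pencil_formE e e1 e2 e3 e4 e5 !mul0r !addr0.
pose v := vec 1 0 0 *m M.
have := vecN (v 0 0) (v 0 1) (v 0 2%:R); rewrite -vec_eta mulmxK // => eqv.
have := f0 (v 0 0) (v 0 1) (v 0 2%:R); rewrite /pencil_form.
have := vecE (l1 (v 0 0) (v 0 1) (v 0 2%:R)) (l2 (v 0 0) (v 0 1) (v 0 2%:R)) (l3 (v 0 0) (v 0 1) (v 0 2%:R)).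
rewrite -eqv !vecE => -[[<- <-] <-].
by rewrite expr0n /= expr1n !mulr0 !addr0 mulr1 => /eqP; apply/negP/form_a_neq0.
Qed.

(** The coefficients of the form of parameter mu are affine in mu, and those of
    the xy term are constant; comparing with [conic_in_pencil] makes mu affine in x
    and then p affine in mu. *)
Lemma denniston_affine : exists e0 e1, forall x, x \in A :\ 0 -> p.[x] = e0 + e1 * x.
Proof.
have D0 := Cxy_neq0.
set g1 := N 2%:R 2%:R ^+ 2; set g0 := a * N 2%:R 0 ^+ 2 + h * N 2%:R 0 * N 2%:R 1 + b * N 2%:R 1 ^+ 2.
have g10 : g1 != 0.
  apply/eqP => g1z; have [x [y [xA yA /eqP xy]]] := A0_two; apply: xy.
  have [mu [_ _ + _ _]] := conic_in_pencil xA; have [mu' [_ _ + _ _]] := conic_in_pencil yA.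
  rewrite /Czz -/g1 g1z !mulr0 !addr0 => -> /(mulIf D0) -> //.
set al1 := N 0 2%:R ^+ 2; set al0 := a * N 0 0 ^+ 2 + h * N 0 0 * N 0 1 + b * N 0 1 ^+ 2.
exists ((al0 - al1 * g0 / g1) / Cxy), (al1 / g1) => x xA.
have [mu [_ _ ez ex _]] := conic_in_pencil xA.
apply: (mulIf D0); rewrite -ex /Cxx -/al0 -/al1.
have -> : mu = (x * Cxy - g0) / g1.
  apply: (mulIf g10); rewrite divfK //; move: ez; rewrite /Czz -/g0 -/g1 => <-.
  by rewrite addrC addKr.
by field; rewrite g10 D0.
Qed.

End NonDenniston.

(** * A large subgroup on which a cubic trace vanishes *)

Section CubicForm.
Variables (F : finFieldType) (m : nat).
Hypothesis hF : #|F| = (2 ^ m)%N.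

(** The polar form of the quadratic form Tr (x ^ 3). *)
Definition cubic_form (x y : F) : F := Tr (x ^+ 2 * y + x * y ^+ 2).

Lemma cubic_formDl x y z : cubic_form (x + y) z = cubic_form x z + cubic_form y z.
Proof. by rewrite /cubic_form -(TrD hF) (sqrD hF); congr Tr; ring. Qed.

Lemma cubic_formC x y : cubic_form x y = cubic_form y x.
Proof. by rewrite /cubic_form; congr Tr; ring. Qed.

Lemma cubic_formDr x y z : cubic_form x (y + z) = cubic_form x y + cubic_form x z.
Proof. by rewrite cubic_formC cubic_formDl !(cubic_formC x). Qed.

Lemma cubic_formxx x : cubic_form x x = 0.
Proof. by rewrite /cubic_form -exprSr -exprS (addrr_char2 hF) (Tr0 hF). Qed.

Lemma cubic_form1 y : cubic_form 1 y = 0.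
Proof. by rewrite /cubic_form expr1n !mul1r (TrD hF) (Tr_sqr hF) (addrr_char2 hF). Qed.

Lemma Tr_cube x y : Tr ((x + y) ^+ 3) = Tr (x ^+ 3) + Tr (y ^+ 3) + cubic_form x y.
Proof.
rewrite /cubic_form -!(TrD hF) exprS (sqrD hF); congr Tr; ring.
Qed.

Definition cubic_perp (A : {set F}) : {set F} := [set y | [forall x in A, cubic_form x y == 0]].

Lemma cubic_perpP (A : {set F}) y :
  reflect (forall x, x \in A -> cubic_form x y = 0) (y \in cubic_perp A).
Proof. by rewrite inE; apply: (iffP forall_inP) => hh x hx; apply/eqP/hh. Qed.

(** Adding to A an element of its orthogonal outside A keeps A isotropic and at
    most halves the orthogonal. The start at the radical element 1 gains the
    factor 2. *)
Lemma isotropic_subgroup j : (2 * j <= m)%N -> exists A : {set F},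
  [/\ zmod_closed A, #|A| = (2 ^ j.+1)%N, A \subset cubic_perp A &
      (2 ^ (m - j) <= #|cubic_perp A|)%N].
Proof.
elim: j => [|j IH] hj.
  exists [set 0; 1]; split.
  - apply: (subgroup_char2 hF) => [|x y]; rewrite !inE ?eqxx //.
    move=> /orP [] /eqP -> /orP [] /eqP ->; rewrite ?addr0 ?add0r ?(addrr_char2 hF) ?eqxx ?orbT //.
  - by rewrite cards2 eq_sym oner_eq0.
  - apply/subsetP => y; rewrite !inE => hy; apply/forall_inP => x; rewrite !inE.
    move=> /orP [] /eqP ->; rewrite ?cubic_form1 //.
    by rewrite /cubic_form expr0n /= !mul0r addr0 (Tr0 hF).
  - rewrite subn0 -hF; apply: subset_leq_card; apply/subsetP => y _; apply/cubic_perpP => x.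
    rewrite !inE => /orP [] /eqP ->; rewrite ?cubic_form1 //.
    by rewrite /cubic_form expr0n /= !mul0r addr0 (Tr0 hF).
have [|A [hA cA iA pA]] := IH; first by lia.
have : ~~ (cubic_perp A \subset A).
  apply/negP => /subset_leq_card; rewrite cA => h1.
  by have := leq_trans pA h1; rewrite leq_exp2l //; lia.
move=> /subsetPn [v /cubic_perpP vp vA].
pose A2 : {set F} := A :|: [set v + y | y in A].
have A2P y : reflect (exists2 x, x \in A & y = x \/ y = v + x) (y \in A2).
  apply: (iffP setUP) => [[yA|/imsetP [x xA ->]]|[x xA [->|->]]].
  - by exists y => //; left.
  - by exists x => //; right.
  - by left.
  - by right; apply: imset_f.
exists A2; split.
- apply: (subgroup_char2 hF) => [|x y /A2P [x' hx ex] /A2P [y' hy ey]].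
    by apply/A2P; exists 0; [exact: subgroup0 | left].
  apply/A2P; exists (x' + y'); first exact: (subgroupD hF hA).
  case: ex => ->; case: ey => ->.
  + by left.
  + by right; ring.
  + by right; ring.
  + left; transitivity (v + v + (x' + y')); first by ring.
    by rewrite (addrr_char2 hF) add0r.
- rewrite cardsU card_imset; last exact: addrI.
  rewrite [A :&: _](_ : _ = set0) ?cards0 ?subn0 ?cA.
    by rewrite [in RHS]expnS mul2n addnn.
  apply/setP => y; rewrite in_set0; apply/negP; rewrite in_setI => /andP [yA /imsetP [x xA ey]].
  by case/negP: vA; rewrite -[v](addrK x) -ey (oppr_char2 hF) (subgroupD hF).
- apply/subsetP => y /A2P [y' hy ey]; apply/cubic_perpP => x /A2P [x' hx ex].
  have yp := cubic_perpP _ _ (subsetP iA _ hy).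
  case: ex => ->; case: ey => ->; rewrite ?cubic_formDl ?cubic_formDr (yp x') //.
  + by rewrite vp // addr0.
  + by rewrite (cubic_formC v) vp // addr0.
  + by rewrite cubic_formxx (cubic_formC v) !vp // !addr0.
- have sub : cubic_perp A :&: [set y | cubic_form v y == 0] \subset cubic_perp A2.
    apply/subsetP => y; rewrite in_setI => /andP [/cubic_perpP h1]; rewrite inE => /eqP h2.
    by apply/cubic_perpP => x /A2P [x' hx [->|->]]; rewrite ?cubic_formDl (h1 x') // h2 addr0.
  set K0 := _ :&: _ in sub; pose K1 := cubic_perp A :\: [set y | cubic_form v y == 0].
  have cK : #|cubic_perp A| = (#|K0| + #|K1|)%N by rewrite (cardsID _ (cubic_perp A)).
  have K10 : (#|K1| <= #|K0|)%N.
    have [->|[y0 hy0]] := set_0Vmem K1; first by rewrite cards0.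
    rewrite -(card_imset K1 (addrI y0)); apply: subset_leq_card.
    have t1 y : y \in K1 -> (forall x, x \in A -> cubic_form x y = 0) /\ cubic_form v y = 1.
      rewrite in_setD inE => /andP [h1 /cubic_perpP h2]; split=> //.
      by case: (Tr01 hF (v ^+ 2 * y + v * y ^+ 2)) h1; rewrite /cubic_form => ->; rewrite ?eqxx.
    apply/subsetP => _ /imsetP [y hy ->].
    have [a1 a2] := t1 _ hy; have [b1 b2] := t1 _ hy0.
    apply/setIP; split; last by rewrite inE cubic_formDr a2 b2 (addrr_char2 hF).
    by apply/cubic_perpP => x xA; rewrite cubic_formDr a1 // b1 // addr0.
  have s1 := subset_leq_card sub.
  have e2 : (2 ^ (m - j) = 2 * 2 ^ (m - j.+1))%N by rewrite -expnS; congr (2 ^ _)%N; lia.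
  by move: pA; rewrite cK e2; lia.
Qed.

Lemma cubic_trace_subgroup : exists (A : {set F}) (c : F),
  [/\ zmod_closed A, #|A| = (2 ^ (m %/ 2 + 1))%N &
      forall x, x \in A -> Tr (x ^+ 3 + c * x) = 0].
Proof.
have [|A [hA cA iA _]] := @isotropic_subgroup (m %/ 2); first by lia.
have [|x y hx hy|c hc] := @trace_represent F m hF A (fun x => Tr (x ^+ 3)) hA.
- by move=> x _; apply: Tr01 hF _.
- by rewrite Tr_cube (cubic_perpP _ _ (subsetP iA _ hy)) // addr0.
exists A, c; split=> //; first by rewrite cA addn1.
by move=> x hx; rewrite (TrD hF) hc // (addrr_char2 hF).
Qed.

End CubicForm.

(** * The two bounds *)

Section Assembly.
Variables (F : finFieldType) (m : nat).
Hypothesis hF : #|F| = (2 ^ m)%N.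

(** Coefficients of [mathon_poly] continued by 0, as [mathon_sum] expects. *)
Definition zero_extend d (a : 'I_d -> F) (k : nat) : F := if insub k is Some i then a i else 0.

Lemma mathon_polyE d (a : 'I_d -> F) x : (mathon_poly a).[x] = mathon_sum (zero_extend a) d x.
Proof.
rewrite horner_sum; apply: eq_bigr => i _.
by rewrite hornerCM hornerXn /zero_extend valK.
Qed.

Lemma mathon_polyD d (a : 'I_d -> F) x y :
  (x + y) * (mathon_poly a).[x + y] = x * (mathon_poly a).[x] + y * (mathon_poly a).[y].
Proof.
have e z : z * (mathon_poly a).[z] = \sum_(i < d) a i * z ^+ (2 ^ i).
  rewrite horner_sum mulr_sumr; apply: eq_bigr => i _.
  by rewrite hornerCM hornerXn mulrCA -exprS subn1 prednK ?pow2_gt0.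
by rewrite !e -big_split; apply: eq_bigr => i _; rewrite (frobD hF) mulrDr.
Qed.

Lemma pq_map_maximal d (K : {set 'M[F]_3}) : generated_by_pq_map d K -> maximal_arc (2 ^ d) K.
Proof.
move=> [a [b [A [hA cA hT ->]]]].
by apply: (pq_arc_maximal hF) => //; apply: mathon_polyD.
Qed.

Lemma large_degree_denniston d (K : {set 'M[F]_3}) : (m + 5 <= 2 * d)%N ->
  generated_by_pq_map d K -> denniston K.
Proof.
move=> md [a [b [A [hA cA hT ->]]]].
have hT' x : x \in A :\ 0 -> Tr (mathon_sum (zero_extend a) d x * mathon_sum (zero_extend b) d x) = 1.
  by move=> hx; rewrite -!mathon_polyE hT.
have z := rigidity hF hA cA md hT'.
have d2 : (2 <= d)%N by have := m_gt0 hF; lia.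
have aff (c : nat -> F) x : (forall i, (2 <= i < d)%N -> c i = 0) ->
    mathon_sum c d x = c 0%N + c 1%N * x.
  move=> hc; have -> : d = (d - 2).+2 by lia.
  rewrite /mathon_sum 2!big_ord_recl big1 ?addr0 /=; first by rewrite expr0 mulr1 expr1.
  by move=> i _; rewrite hc ?mul0r //= /bump /=; have := ltn_ord i; lia.
apply: (affine_denniston hF (a0 := zero_extend a 0) (a1 := zero_extend a 1) (b0 := zero_extend b 0) (b1 := zero_extend b 1)) => //.
- exact: (Tr_const_term hF hA cA hT').
- by move=> x _; rewrite mathon_polyE aff // => i /z [].
- by move=> x _; rewrite mathon_polyE aff // => i /z [].
Qed.

Lemma cubic_arc : (7 <= m)%N -> has_non_denniston_pq_arc F (m %/ 2 + 1).
Proof.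
move=> m7; have [A [c [hA cA hc]]] := cubic_trace_subgroup hF.
set d := (m %/ 2 + 1)%N in cA *; have d4 : (4 <= d)%N by rewrite /d; lia.
have [a0 ha0] := Tr_nonzero hF.
pose a (i : 'I_d) : F := [:: a0; c; 1]`_i.
pose b (i : 'I_d) : F := [:: 1]`_i.
have val3 (s : seq F) x : (size s <= 3)%N ->
    (mathon_poly (fun i : 'I_d => s`_i)).[x] = s`_0 + s`_1 * x + s`_2 * x ^+ 3.
  move=> hs; rewrite horner_sum; have -> : d = (d - 3).+3 by lia.
  rewrite 3!big_ord_recl big1 ?addr0 /= => [|i _].
    by rewrite !hornerCM !hornerXn /= expr0 mulr1 expr1 addrA.
  by rewrite hornerCM nth_default ?mul0r // /bump /=; apply: leq_trans hs _; lia.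
have pE x : (mathon_poly a).[x] = a0 + c * x + x ^+ 3 by rewrite val3 //= mul1r.
have qE x : (mathon_poly b).[x] = 1 by rewrite val3 //= !mul0r !addr0.
have hT x : x \in A :\ 0 -> Tr ((mathon_poly a).[x] * (mathon_poly b).[x]) = 1.
  rewrite !inE => /andP [_ xA].
  by rewrite pE qE mulr1 -addrA [c * x + _]addrC (TrD hF) ha0 hc // addr0.
have gen : generated_by_pq_map d (pq_arc (mathon_poly a) (mathon_poly b) A).
  by exists a, b, A; split.
exists (pq_arc (mathon_poly a) (mathon_poly b) A); split=> //; first exact: pq_map_maximal.
move=> [a' [h' [b' [A' [irr _ [M uM hK]]]]]].
have dm : (4 * 2 ^ d < 2 ^ m)%N.
  by rewrite -[4%N]/(2 ^ 2)%N -expnD ltn_exp2l //; rewrite /d; lia.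
have [|e0 [e1 he]] := denniston_affine hF hA cA hT (@mathon_polyD _ a) (@mathon_polyD _ b) _ dm irr uM hK.
  by lia.
pose r : {poly F} := Poly [:: a0 - e0; c - e1; 0; 1].
have r0 : r != 0.
  apply/eqP => /(congr1 (fun r : {poly F} => r`_3)) /eqP.
  by rewrite coef_Poly coef0 /= oner_eq0.
have hall : all (root r) (enum (A :\ 0)).
  apply/allP => x; rewrite mem_enum => xA; rewrite /root horner_Poly /=.
  have := he x xA; rewrite pE => e.
  apply/eqP; transitivity (a0 + c * x + x ^+ 3 - (e0 + e1 * x)); last by rewrite e subrr.
  ring.
have := max_poly_roots r0 hall (enum_uniq _); rewrite -cardE (card_subgroup_nonzero hA cA) => h1.
have h2 := size_Poly [:: a0 - e0; c - e1; 0; 1].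
have := leq_trans h1 h2; have := pow2_le d4; rewrite /=; lia.
Qed.

End Assembly.

Local Close Scope ring_scope.

Theorem theorem3p2 (m : nat) (F : finFieldType) (hm : (7 <= m)%N)
    (hm9 : m <> 9) (hF : #|F| = (2 ^ m)%N) :
  exists d : nat,
    (d = (m %/ 2 + 1)%N \/ d = (m %/ 2 + 2)%N) /\
    is_largest (has_non_denniston_pq_arc F) d.
Proof.
have low := cubic_arc hF hm.
have up d : has_non_denniston_pq_arc F d -> (d <= m %/ 2 + 2)%N.
  move=> [K [gen _ nd]]; rewrite leqNgt; apply/negP => hd; apply: nd.
  have md : (m + 5 <= 2 * d)%N by lia.
  exact: (large_degree_denniston hF md gen).
have [h2|h2] := classic (has_non_denniston_pq_arc F (m %/ 2 + 2)).
  by exists (m %/ 2 + 2)%N; split; [right | split].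
exists (m %/ 2 + 1)%N; split; [by left | split=> // d hd].
have := up d hd; rewrite leq_eqVlt => /orP [/eqP e|]; last by rewrite addn2 addn1.
by case: h2; rewrite -e.
Qed.
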